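(* Let $\lambda\in\,]0,1]$, $\theta\in\,]0,1[$ with $1/\theta\ge1+\lambda$, and let $(J_t)_{t\ge0}$, $J_t=PY_tQY_t^\star P$, be a free Jacobi process with parameters $(\lambda,\theta)$ started at $J_0=PY_0QY_0^\star P$ with $0<J_0<P$, i.e. $J_0$ and $P-J_0$ are invertible in $P\mathscr{A}P$. Let $$T:=\inf\{s:\ker(J_s)\ne\ker P\ \text{ or }\ \ker(P-J_s)\ne\ker P\}$$ and $m_n(t):=\tilde\Phi(J_t^n)$ for $n\ge0$ (so $m_0=1$). Then for every $n\ge2$ and $t<T$, $$m_n(t)=m_n(0)-n\int_0^tm_n(s)\,ds+n\theta\int_0^tm_{n-1}(s)\,ds+\lambda\theta\,n\sum_{k=0}^{n-2}\int_0^tm_{n-k-1}(s)\,(m_k(s)-m_{k+1}(s))\,ds,$$ or equivalently $$\frac{dm_n(t)}{dt}=-n\,m_n(t)+n\theta\,m_{n-1}(t)+\lambda\theta\,n\sum_{k=0}^{n-2}m_{n-k-1}(t)\,(m_k(t)-m_{k+1}(t)).$$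
   Context: $(\mathscr{A},(\mathscr{A}_t)_{t\ge0},\Phi)$ is a filtered $W^\star$ non-commutative probability space: $\mathscr{A}$ is a von Neumann algebra acting on a Hilbert space, $\Phi$ a faithful normal tracial state, $(\mathscr{A}_t)$ an increasing family of unital weakly closed $\star$-subalgebras. An $(\mathscr{A}_t)$-free (additive) Brownian motion is a self-adjoint process $X$ with $X_0=0$, $X_t\in\mathscr{A}_t$, and, for $s<t$, $X_t-X_s$ free from $\mathscr{A}_s$ and semicircular of mean $0$ and variance $t-s$. Free Jacobi process: $P,Q\in\mathscr{A}$ are projections with $\Phi(P)=\lambda\theta$, $\Phi(Q)=\theta$ and (here $\lambda\le1$) $PQ=QP=P$. $Y$ is a free multiplicative Brownian motion started at a unitary $Y_0$, i.e. the unitary solution of $dY_t=i\,dX_t\,Y_t-\frac12Y_t\,dt$ with $X$ an $(\mathscr{A}_t)$-free Brownian motion; equivalently $Y_t=Y^0_tY_0$ with $Y^0$ the solution started at $1$. $\{Y^0_t,(Y^0_t)^\star:t\ge0\}$ is free from $\{P,Q\}$, and $Y_0$ is free from $Y^0$ and from $\{P,Q\}$; $P,Q,Y_0\in\mathscr{A}_0$. $J_t=PY_tQY_t^\star P$ is considered in $(P\mathscr{A}P,\tilde\Phi)$, $\tilde\Phi=\frac1{\lambda\theta}\Phi|_{P\mathscr{A}P}$, with unit $P$ (and $J_t^0=P$). *)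

(* Defs.v *)
From HB Require Import structures.
From mathcomp Require Import all_boot all_order all_algebra.
From mathcomp Require Import all_classical all_reals all_analysis.
From mathcomp Require Import complex.

Set Implicit Arguments.
Unset Strict Implicit.
Unset Printing Implicit Defensive.

Import Order.TTheory GRing.Theory Num.Theory numFieldNormedType.Exports.

Local Open Scope classical_set_scope.
Local Open Scope ring_scope.
Local Open Scope complex_scope.

(* Operators are plain functions on a complex Hilbert space [H]: sums and
   scalings are pointwise, the product is composition and the unit is [idfun]. *)

Section Operators.
Context {R : realType} {H : completeNormedModType R[i]}.
Implicit Types (ip : {dot H for Num.conj}) (a b : H -> H).

(* The Banach norm of [H] is the one of the inner product, which is linear in
   its first argument and conjugate-linear in the second. *)
Definition is_hilbert ip := forall x : H, `|x| ^+ 2 = ip x x.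

Definition bounded_op a := linear a /\ continuous a.

Definition is_adjoint ip a b := forall x y : H, ip (a x) y = ip x (b y).

Definition self_adjoint ip a := is_adjoint ip a a.

(* Only meaningful when the adjoint exists, as it does for the elements of a
   [star_algebra]; it is then unique. *)
Definition adj ip a : H -> H := xget 0 [set b | is_adjoint ip a b].

(* The order of self-adjoint operators; in [R[i]], [0 <= z] means that [z] is
   real and nonnegative. *)
Definition op_le ip a b := forall x : H, 0 <= ip (b x - a x) x.

Definition op_ker a : set H := a @^-1` [set 0].

Definition star_algebra ip (B : set (H -> H)) : Prop :=
  [/\ B `<=` bounded_op,
      B idfun,
      (forall (k : R[i]) a b, B a -> B b -> B (k *: a + b)),
      (forall a b, B a -> B b -> B (a \o b)) &
      (forall a, B a -> exists2 b, B b & is_adjoint ip a b)].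

(* Closedness in the weak operator topology: [a] belongs to [B] as soon as all
   the basic weak neighbourhoods of [a] meet [B]. *)
Definition weakly_closed ip (B : set (H -> H)) : Prop :=
  forall a, bounded_op a ->
    (forall (s : seq (H * H)) (e : R), 0 < e ->
      exists2 b, B b & forall p, p \in s -> `|ip (a p.1 - b p.1) p.2| < e%:C) ->
    B a.

Definition von_neumann_algebra ip (A : set (H -> H)) : Prop :=
  star_algebra ip A /\ weakly_closed ip A.

Definition is_projection ip (p : H -> H) := self_adjoint ip p /\ p \o p = p.

Definition unitary_op ip (u : H -> H) :=
  adj ip u \o u = idfun /\ u \o adj ip u = idfun.

(* The compressed algebra [p A p], whose unit is [p]. *)
Definition corner (A : set (H -> H)) (p : H -> H) : set (H -> H) :=
  [set a | A a /\ p \o a \o p = a].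

Definition corner_invertible (A : set (H -> H)) (p a : H -> H) : Prop :=
  exists2 b, corner A p b & a \o b = p /\ b \o a = p.

Definition corner_exp (p a : H -> H) (n : nat) : H -> H :=
  iter n (fun b => a \o b) p.

Lemma adjE ip a b : is_adjoint ip a b -> adj ip a = b.
Proof.
move=> ab; rewrite /adj; case: xgetP => [c _ ac|/(_ b)//].
apply/funext => y; apply/eqP; rewrite -subr_eq0 -(dnorm_eq0 ip).
set u := c y - b y; have /eqP : ip u (c y) - ip u (b y) = 0.
  by rewrite -ab -ac subrr.
by rewrite -linearBr; exact: id.
Qed.

Lemma self_adjoint_corner_exp ip (p a : H -> H) n :
  self_adjoint ip p -> self_adjoint ip a -> p \o a = a -> a \o p = a ->
  self_adjoint ip (corner_exp p a n).
Proof.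
move=> pp aa pa ap; elim: n => [//|n IHn] x y /=.
have comm m : a \o corner_exp p a m = corner_exp p a m \o a.
  elim: m => [|m IHm]; first by rewrite /corner_exp /= ap pa.
  rewrite -[RHS]/(a \o (corner_exp p a m \o a)) -IHm.
  by [].
by rewrite aa IHn -[corner_exp p a n (a y)]/((corner_exp p a n \o a) y) -comm.
Qed.

End Operators.

Section FreeProbability.
Context {R : realType} {H : completeNormedModType R[i]}.
Context (ip : {dot H for Num.conj}) (A : set (H -> H)).
Implicit Types (Phi : (H -> H) -> R[i]) (F : R -> set (H -> H)).
Implicit Types (a b d : H -> H).

(* Preservation of the suprema of bounded increasing nets of self-adjoint
   elements. *)
Definition normal_functional Phi : Prop :=
  forall (D : set (H -> H)) (s : H -> H),
    D !=set0 -> (forall d, D d -> A d /\ self_adjoint ip d) ->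
    (forall a b, D a -> D b -> exists2 d, D d & op_le ip a d /\ op_le ip b d) ->
    A s -> self_adjoint ip s -> (forall d, D d -> op_le ip d s) ->
    (forall u : H -> H, A u -> self_adjoint ip u -> (forall d, D d -> op_le ip d u) ->
      op_le ip s u) ->
    forall e : R, 0 < e -> exists2 d, D d & Phi s - e%:C < Phi d.

Record faithful_normal_tracial_state Phi : Prop := {
  state_linear : forall (k : R[i]) a b, A a -> A b ->
    Phi (k *: a + b) = k * Phi a + Phi b ;
  state_unit : Phi idfun = 1 ;
  state_positive : forall a, A a -> 0 <= Phi (adj ip a \o a) ;
  state_faithful : forall a, A a -> Phi (adj ip a \o a) = 0 -> a = 0 ;
  state_tracial : forall a b, A a -> A b -> Phi (a \o b) = Phi (b \o a) ;
  state_normal : normal_functional Phi }.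

Record is_filtration F : Prop := {
  filtration_algebra : forall t : R, 0 <= t -> star_algebra ip (F t) ;
  filtration_closed : forall t : R, 0 <= t -> weakly_closed ip (F t) ;
  filtration_sub : forall t : R, 0 <= t -> F t `<=` A ;
  filtration_incr : forall s t : R, 0 <= s -> s <= t -> F s `<=` F t }.

Record filtered_Wstar_space F Phi : Prop := {
  fspace_hilbert : is_hilbert ip ;
  fspace_algebra : von_neumann_algebra ip A ;
  fspace_state : faithful_normal_tracial_state Phi ;
  fspace_filtration : is_filtration F }.

(* The unital star-subalgebra generated by [S]. *)
Definition alg_gen (S : set (H -> H)) : set (H -> H) :=
  [set a | forall B, star_algebra ip B -> S `<=` B -> B a].

(* Freeness of the generated algebras: alternating products of centred elements
   are centred. *)
Definition free_family Phi (I : Type) (S : I -> set (H -> H)) : Prop :=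
  forall (n : nat) (c : nat -> I) (a : nat -> H -> H),
    (forall i, (i < n)%N -> c i <> c i.+1) ->
    (forall i, (i <= n)%N -> alg_gen (S (c i)) (a i) /\ Phi (a i) = 0) ->
    Phi (\big[(fun f g => f \o g)/idfun]_(i < n.+1) a i) = 0.

Definition free_sets Phi (S1 S2 : set (H -> H)) : Prop :=
  free_family Phi (fun b : bool => if b then S1 else S2).

(* The distribution of [a] is the centred semicircle law of variance [v];
   [iter n a] is the [n]-th power of the operator [a]. *)
Definition semicircular Phi a (v : R) : Prop :=
  self_adjoint ip a /\
  forall n : nat, Phi (iter n a) =
    (\int[lebesgue_measure]_(x in `[- (2 * Num.sqrt v), 2 * Num.sqrt v])
       (x ^+ n * (Num.sqrt (4 * v - x ^+ 2) / (2 * pi * v))))%:C.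

Record free_brownian_motion F Phi (X : R -> H -> H) : Prop := {
  fbm_start : X 0 = 0 ;
  fbm_adapted : forall t : R, 0 <= t -> F t (X t) ;
  fbm_self_adjoint : forall t : R, 0 <= t -> self_adjoint ip (X t) ;
  fbm_free : forall s t : R, 0 <= s -> s < t ->
    free_sets Phi [set X t - X s] (F s) ;
  fbm_semicircular : forall s t : R, 0 <= s -> s < t ->
    semicircular Phi (X t - X s) (t - s) }.

(* The step process equal to [sp_val i] on [sp_time i, sp_time i.+1[ for
   [i < sp_size] and to [0] elsewhere. *)
Record simple_process := SimpleProcess {
  sp_size : nat ;
  sp_time : nat -> R ;
  sp_val : nat -> H -> H }.

Definition simple_adapted F (V : simple_process) : Prop :=
  [/\ 0 <= sp_time V 0,
      (forall i, (i < sp_size V)%N -> sp_time V i <= sp_time V i.+1) &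
      (forall i, (i < sp_size V)%N -> F (sp_time V i) (sp_val V i))].

Definition simple_at (V : simple_process) (s : R) : H -> H :=
  \sum_(i < sp_size V)
    (if sp_time V i <= s < sp_time V i.+1 then sp_val V i else 0).

(* [\int_0^t dZ_s V_s] *)
Definition simple_integral (Z : R -> H -> H) (V : simple_process) (t : R)
    : H -> H :=
  \sum_(i < sp_size V)
    ((Z (Num.min t (sp_time V i.+1)) - Z (Num.min t (sp_time V i)))
       \o sp_val V i).

(* The squared norm of [L^2(Phi)]. *)
Definition l2sq Phi a : R := complex.Re (Phi (adj ip a \o a)).

(* [I = \int_0^t dZ_s U_s]: the extension by [L^2] continuity of the integral of
   adapted simple processes. For a free Brownian motion [Z] this is the
   free stochastic integral of the biprocess [1 \otimes U]; for
   [Z = time_process] it is the Bochner integral of [U] in [L^2(Phi)]. *)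
Definition is_L2_integral F Phi (Z U : R -> H -> H) (t : R) (I : H -> H)
    : Prop :=
  exists V : nat -> simple_process,
    [/\ (forall k, simple_adapted F (V k)),
        (forall k, measurable_fun `[0, t]
           (fun s : R => l2sq Phi (simple_at (V k) s - U s))),
        (fun k => (\int[lebesgue_measure]_(s in `[0%R, t])
            (l2sq Phi (simple_at (V k) s - U s))%:E)%E) @ \oo --> 0%E &
        (fun k => l2sq Phi (simple_integral Z (V k) t - I)) @ \oo --> (0 : R)].

Definition time_process (t : R) : H -> H := t%:C *: idfun.

(* Unitary adapted solutions of [dY_t = i dX_t Y_t - (1/2) Y_t dt]. *)
Record free_mult_brownian_motion F Phi (X Y : R -> H -> H) : Prop := {
  fmbm_adapted : forall t : R, 0 <= t -> F t (Y t) ;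
  fmbm_unitary : forall t : R, 0 <= t -> unitary_op ip (Y t) ;
  fmbm_sde : forall t : R, 0 <= t -> exists I D : H -> H,
    [/\ A I, A D,
        is_L2_integral F Phi X Y t I,
        is_L2_integral F Phi time_process Y t D &
        Y t = Y 0 + 'i *: I - (2^-1 : R)%:C *: D] }.

(* [Z] is the multiplicative Brownian motion started at the unit and [Y 0] the
   initial unitary, so that [Y t = Z t \o Y 0]. *)
Record free_jacobi_setting F Phi (lambda theta : R) (P Q : H -> H)
    (X Z Y : R -> H -> H) : Prop := {
  fj_P0 : F 0 P ;
  fj_Q0 : F 0 Q ;
  fj_P : is_projection ip P ;
  fj_Q : is_projection ip Q ;
  fj_trP : Phi P = (lambda * theta)%:C ;
  fj_trQ : Phi Q = theta%:C ;
  fj_PQ : P \o Q = P ;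
  fj_QP : Q \o P = P ;
  fj_X : free_brownian_motion F Phi X ;
  fj_Y : free_mult_brownian_motion F Phi X Y ;
  fj_Z : free_mult_brownian_motion F Phi X Z ;
  fj_Z0 : Z 0 = idfun ;
  fj_YE : forall t : R, 0 <= t -> Y t = Z t \o Y 0 ;
  fj_freeZPQ : free_sets Phi
    [set a | exists2 t : R, 0 <= t & a = Z t \/ a = adj ip (Z t)] [set P; Q] ;
  fj_freeY0Z : free_sets Phi
    [set Y 0] [set a | exists2 t : R, 0 <= t & a = Z t \/ a = adj ip (Z t)] ;
  fj_freeY0PQ : free_sets Phi [set Y 0] [set P; Q] }.

Definition jacobi (P Q : H -> H) (Y : R -> H -> H) (t : R) : H -> H :=
  P \o Y t \o Q \o adj ip (Y t) \o P.

(* The infimum is [+oo] when the set is empty. *)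
Definition jacobi_time (P : H -> H) (J : R -> H -> H) : \bar R :=
  ereal_inf [set s%:E | s in
    [set s : R | 0 <= s /\ (op_ker (J s) <> op_ker P \/ op_ker (P - J s) <> op_ker P)]].

(* [Phi] restricted to [P A P] and normalised by [c = Phi P]. *)
Definition compressed_state Phi (c : R) a : R[i] := (c^-1)%:C * Phi a.

(* The moment of order [n] is real, see [momentE]. *)
Definition moment Phi (c : R) (P : H -> H) (J : R -> H -> H) (n : nat) (t : R)
    : R :=
  complex.Re (compressed_state Phi c (corner_exp P (J t) n)).

Lemma state_real Phi a :
  von_neumann_algebra ip A -> faithful_normal_tracial_state Phi ->
  A a -> self_adjoint ip a -> Phi a = (complex.Re (Phi a))%:C.
Proof.
move=> [[Ab A1 Alin Amul _] _] PhiP Aa sa.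
have Aa1 : A (a + idfun) by rewrite -[a]scale1r; exact: Alin.
have sa1 : self_adjoint ip (a + idfun).
  move=> x y; rewrite -[LHS]/(ip (a x + x) y) -[RHS]/(ip x (a y + y)).
  by rewrite [LHS]linearDl [RHS]linearDr; congr (_ + _); exact: sa.
have lin k b c := @state_linear _ PhiP k b c.
have := state_positive PhiP Aa; rewrite (adjE sa).
have := state_positive PhiP Aa1; rewrite (adjE sa1).
have -> : (a + idfun) \o (a + idfun) =
          1 *: (a \o a) + (1 *: a + (1 *: a + idfun)).
  apply/funext => x; have [alin _] := Ab _ Aa.
  have aD u v : a (u + v) = a u + a v by have := alin 1 u v; rewrite !scale1r.
  by rewrite !scale1r -[LHS]/(a (a x + x) + (a x + x)) aD -addrA.
have Aa1' : A (1 *: a + idfun) by exact: Alin.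
have Aa2 : A (1 *: a + (1 *: a + idfun)) by exact: Alin.
have Aaa : A (a \o a) by exact: Amul.
rewrite !lin // (state_unit PhiP) !mul1r.
case: (Phi a) => u v; case: (Phi _) => u' v' /=.
rewrite !lecE /= => /andP[/eqP h1 _] /andP[/eqP h2 _].
congr (_ +i* _); move: h1; rewrite h2 add0r addr0 => /eqP.
by rewrite -mulr2n mulrn_eq0 /= => /eqP.
Qed.

(* The derivative of [f] at [t] as a function on [0, +oo[; it is one-sided
   at [t = 0]. *)
Definition is_derive_halfline (f : R -> R) (t df : R) : Prop :=
  (fun s => (f s - f t) / (s - t)) @ within [set s | 0 <= s] t^' --> df.

Lemma momentE F Phi (lambda theta : R) (P Q : H -> H) (X Z Y : R -> H -> H)
    (n : nat) (t : R) :
  filtered_Wstar_space F Phi ->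
  free_jacobi_setting F Phi lambda theta P Q X Z Y -> 0 <= t ->
  compressed_state Phi (lambda * theta) (corner_exp P (jacobi P Q Y t) n) =
  (moment Phi (lambda * theta) P (jacobi P Q Y) n t)%:C.
Proof.
move=> [_ vnA PhiP [_ _ FA _]] fj t0; have [[_ _ _ Amul Aadj] _] := vnA.
have AP : A P by exact: (FA 0 _ _ (fj_P0 fj)).
have AQ : A Q by exact: (FA 0 _ _ (fj_Q0 fj)).
have AY : A (Y t) by exact: FA (fmbm_adapted (fj_Y fj) t0).
have [b Ab Yb] := Aadj _ AY; have [sP PP] := fj_P fj; have [sQ _] := fj_Q fj.
have AJ : A (jacobi P Q Y t).
  rewrite /jacobi (adjE Yb).
  exact: (Amul _ _ (Amul _ _ (Amul _ _ (Amul _ _ AP AY) AQ) Ab) AP).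
have sJ : self_adjoint ip (jacobi P Q Y t).
  have bY x y : ip (b x) y = ip x (Y t y).
    by rewrite hermC [RHS]hermC; congr (_ * Num.conj _); symmetry; exact: Yb.
  move=> x y; rewrite /jacobi (adjE Yb) /=.
  by rewrite [LHS]sP [LHS]Yb [LHS]sQ [LHS]bY [LHS]sP.
have Ae : A (corner_exp P (jacobi P Q Y t) n).
  by elim: n => // n IHn; exact: Amul.
have PPx x : P (P x) = P x by rewrite -[LHS]/((P \o P) x) PP.
have se : self_adjoint ip (corner_exp P (jacobi P Q Y t) n).
  by apply: self_adjoint_corner_exp => //; apply/funext => x;
  rewrite /jacobi /= PPx.
rewrite /moment /compressed_state (state_real vnA PhiP Ae se).
by rewrite -rmorphM.
Qed.

End FreeProbability.

(* Main.v *)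
(**
  Write [U_t = Y_t Q Y_t^*] and [W = i (X_{t+h} - X_t)].  The stochastic
  equation gives [Y_{t+h} = (1 + W - h / 2) Y_t + E], where [E] has L2 norm
  [O(h)] and, the stochastic integral being a martingale, is orthogonal to the
  past up to [O(h^(3/2))].  Hence [U_{t+h} - U_t] is the commutator [W U - U W]
  up to [O(h)] in L2.  The word [(P U_{t+h})^n] is expanded to the second order
  around [(P U_t)^n] by telescoping; freeness of [W] from the past evaluates
  the terms of first and second order, since [tau (W a) = 0] and
  [tau (W a W b) = - h tau a tau b], and the remainder is [O(h^(3/2))] because
  [W] has operator norm at most [2 sqrt h].  So the moments satisfy
  [m_n (t + h) - m_n t = h G_n t + O(h^(3/2))] uniformly in [t >= 0], which
  gives both the differential and the integral equation.
*)
Require Import Defs.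
From HB Require Import structures.
From mathcomp Require Import all_boot all_order all_algebra.
From mathcomp Require Import all_classical all_reals all_analysis.
From mathcomp Require Import complex measurable_realfun.
From mathcomp Require Import ring lra zify.

Set Implicit Arguments.
Unset Strict Implicit.
Unset Printing Implicit Defensive.

Import Order.TTheory GRing.Theory Num.Theory numFieldNormedType.Exports.
Local Open Scope classical_set_scope.
Local Open Scope ring_scope.
Local Open Scope complex_scope.

(** * Star-algebras with a tracial state *)

(** The obstacle is that [E], and with it [Y_{t+h} - Y_t] beyond its [W] part, is small in L2 norm
    only, and a product of two such elements has no L2 bound. Orders in [sqrt h] are therefore
    tracked in two scales, L2 norm and operator norm, and at most two factors of a word under the
    trace may be measured in L2. Hence the increment of [U] is replaced by its commutator part,
    small in operator norm, before it is multiplied by another small factor. The order of [E] needs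
    a bootstrap: unitarity bounds [|Y_r - Y_t|^2] by 4, which makes [Y] Hölder of exponent 1/2 in
    L2, and this fed back into the same estimate gives [O(h)]. The part of [E] coming from [dX] is
    exactly orthogonal to the past; only the part coming from [dt], itself [O(h^(3/2))] in L2, is
    not. The operator norm is expressed through the trace, as the norm of multiplication on L2. For
    [W] it is recovered from the semicircle moments, of which the one of order [n] is at most
    [(2 sqrt h)^n]. All of this takes place in an abstract algebra with involution and trace; the
    operators in [A] are made into such an algebra later. *)

Record tracial_star (R : realType) (T : algType R[i]) (star : T -> T)
    (tau : T -> R[i]) : Prop := {
  starD : {morph star : a b / a + b} ;
  starZ : forall k a, star (k *: a) = k^*%C *: star a ;
  starM : forall a b, star (a * b) = star b * star a ;
  starK : involutive star ;
  tauP : forall k a b, tau (k *: a + b) = k * tau a + tau b ;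
  tau1 : tau 1 = 1 ;
  tau_comm : forall a b, tau (a * b) = tau (b * a) ;
  tau_ge0 : forall a, 0 <= tau (star a * a) }.

Section TracialStar.
Context {R : realType} {T : algType R[i]} (star : T -> T) (tau : T -> R[i]).
Hypothesis tsP : tracial_star star tau.
Implicit Types (a b d w v : T) (K L : R).

Lemma star1 : star 1 = 1.
Proof.
by rewrite -[LHS](mul1r _) -{1}(starK tsP 1) -(starM tsP) mul1r (starK tsP).
Qed.

Lemma starZr r a : star (r%:C *: a) = r%:C *: star a.
Proof. by rewrite (starZ tsP) conjc_real. Qed.

Lemma starN a : star (- a) = - star a.
Proof.
by rewrite -scaleN1r (starZ tsP) rmorphN rmorph1 scaleN1r.
Qed.

Lemma starB a b : star (a - b) = star a - star b.
Proof. by rewrite (starD tsP) starN. Qed.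

Lemma star0 : star 0 = 0.
Proof. by rewrite -[X in star X](subrr 0) starB subrr. Qed.

Lemma star_sum (I : Type) (s : seq I) (f : I -> T) :
  star (\sum_(i <- s) f i) = \sum_(i <- s) star (f i).
Proof. exact: (big_morph _ (starD tsP) star0). Qed.

Lemma tauD a b : tau (a + b) = tau a + tau b.
Proof. by rewrite -{1}[a]scale1r (tauP tsP) mul1r. Qed.

Lemma tau0 : tau 0 = 0.
Proof. by apply: (addIr (tau 0)); rewrite -tauD !add0r. Qed.

Lemma tauZ k a : tau (k *: a) = k * tau a.
Proof. by rewrite -[k *: a]addr0 (tauP tsP) tau0 addr0. Qed.

Lemma tauN a : tau (- a) = - tau a.
Proof. by rewrite -scaleN1r tauZ mulN1r. Qed.

Lemma tauB a b : tau (a - b) = tau a - tau b.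
Proof. by rewrite tauD tauN. Qed.

Definition retr a : R := complex.Re (tau a).

Lemma retrD a b : retr (a + b) = retr a + retr b.
Proof. by rewrite /retr tauD; case: (tau a) (tau b) => ? ? []. Qed.

Lemma retr0 : retr 0 = 0. Proof. by rewrite /retr tau0. Qed.

Lemma retrN a : retr (- a) = - retr a.
Proof. by rewrite /retr tauN; case: (tau a). Qed.

Lemma retrB a b : retr (a - b) = retr a - retr b.
Proof. by rewrite retrD retrN. Qed.

Lemma retrZ r a : retr (r%:C *: a) = r * retr a.
Proof. by rewrite /retr tauZ; case: (tau a) => x y /=; rewrite mul0r subr0. Qed.

Lemma retr_sum (I : Type) (s : seq I) (f : I -> T) :
  retr (\sum_(i <- s) f i) = \sum_(i <- s) retr (f i).
Proof. exact: (big_morph _ retrD retr0). Qed.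

Lemma retr_comm a b : retr (a * b) = retr (b * a).
Proof. by rewrite /retr (tau_comm tsP). Qed.

(** Positivity makes the trace of [star (a + k) * (a + k)] real for every scalar [k]; the values 1
    and [i] of [k] then compare the imaginary and the real parts. *)
Lemma tau_star a : tau (star a) = (tau a)^*%C.
Proof.
have rl k : complex.Im (k * tau (star a) + k^*%C * tau a) = 0.
  have := tau_ge0 tsP (a + k *: 1).
  rewrite (starD tsP) (starZ tsP) star1 mulrDl !mulrDr -!scalerAr -!scalerAl.
  rewrite !mulr1 mul1r scalerA !tauD !tauZ (tau1 tsP) mulr1.
  have := tau_ge0 tsP a; rewrite !lecE.
  case: (tau (star a * a)) => u v; case: (tau (star a)) => u1 v1.
  case: (tau a) => u2 v2; case: k => u3 v3 /=.
  move=> /andP[/eqP -> _] /andP[/eqP h _].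
  by move: h; rewrite /= => h; lra.
have := rl 1; have := rl 'i%C.
case: (tau (star a)) => u1 v1; case: (tau a) => u2 v2 /=.
move=> h1 h2; congr (_ +i* _)%C; lra.
Qed.

Lemma retr_star a : retr (star a) = retr a.
Proof. by rewrite /retr tau_star; case: (tau a). Qed.

Definition nsq a := retr (star a * a).

Lemma nsq_ge0 a : 0 <= nsq a.
Proof.
have := tau_ge0 tsP a; rewrite /nsq /retr.
by case: (tau _) => u v; rewrite lecE /= => /andP[].
Qed.

Lemma nsq_star a : nsq (star a) = nsq a.
Proof. by rewrite /nsq (starK tsP) retr_comm. Qed.

Lemma nsq_expand a b : nsq (a + b) = nsq a + 2 * retr (star a * b) + nsq b.
Proof.
rewrite /nsq (starD tsP) mulrDl !mulrDr !retrD.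
have -> : retr (star b * a) = retr (star a * b).
  by rewrite -retr_star (starM tsP) (starK tsP).
by ring.
Qed.

Lemma nsqZ r a : nsq (r%:C *: a) = r ^+ 2 * nsq a.
Proof.
by rewrite /nsq starZr -scalerAl -scalerAr scalerA -rmorphM retrZ expr2.
Qed.

Lemma nsqi a : nsq ('i%C *: a) = nsq a.
Proof.
rewrite /nsq (starZ tsP) -scalerAl -scalerAr scalerA -[LHS](mul1r _).
rewrite -retrZ; congr retr; rewrite scalerA -[RHS]scale1r; congr (_ *: _).
by apply/eqP; rewrite eq_complex /=; apply/andP; split; apply/eqP; ring.
Qed.

Lemma nsqN a : nsq (- a) = nsq a.
Proof. by rewrite /nsq starN mulrNN. Qed.

Lemma nsq0 : nsq 0 = 0.
Proof. by rewrite /nsq mulr0 retr0. Qed.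

Lemma nsqD_le a b : nsq (a + b) <= 2 * nsq a + 2 * nsq b.
Proof.
have := nsq_ge0 (a - b); rewrite nsq_expand nsqN mulrN retrN => h.
by rewrite nsq_expand; lra.
Qed.

Lemma retr_CS2 a b : retr (star a * b) ^+ 2 <= nsq a * nsq b.
Proof.
set B := retr _.
have key r s : 0 <= r ^+ 2 * nsq a + 2 * (r * s) * B + s ^+ 2 * nsq b.
  have := nsq_ge0 (r%:C *: a + s%:C *: b).
  have -> : nsq (r%:C *: a + s%:C *: b) =
      r ^+ 2 * nsq a + 2 * (r * (s * B)) + s ^+ 2 * nsq b.
    rewrite nsq_expand starZr !nsqZ; congr (_ + 2 * _ + _).
    by rewrite -scalerAl -scalerAr !retrZ.
  by have -> : 2 * (r * s) * B = 2 * (r * (s * B)) by ring.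
have a0 := nsq_ge0 a; have := nsq_ge0 b; rewrite le0r => /orP[/eqP b0|b0].
  rewrite b0 mulr0 leNgt; apply/negP => B0.
  (* The discriminant argument degenerates when [nsq b = 0]. This choice of coefficients makes the
     quadratic form equal to [- B ^+ 2]. *)
  have := key B (- (nsq a + 1) / 2); rewrite b0 mulr0 addr0.
  have -> : B ^+ 2 * nsq a + 2 * (B * (- (nsq a + 1) / 2)) * B = - B ^+ 2.
    by field.
  by lra.
have := key (nsq b) (- B).
have -> : nsq b ^+ 2 * nsq a + 2 * (nsq b * - B) * B + (- B) ^+ 2 * nsq b
  = nsq b * (nsq a * nsq b - B ^+ 2) by ring.
by rewrite pmulr_rge0 // subr_ge0.
Qed.

Definition nrm a := Num.sqrt (nsq a).

Lemma nrm_ge0 a : 0 <= nrm a. Proof. exact: sqrtr_ge0. Qed.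

Lemma nrm_sqr a : nrm a ^+ 2 = nsq a.
Proof. by rewrite sqr_sqrtr ?nsq_ge0. Qed.

Lemma nrm_star a : nrm (star a) = nrm a.
Proof. by rewrite /nrm nsq_star. Qed.

Lemma nrmN a : nrm (- a) = nrm a. Proof. by rewrite /nrm nsqN. Qed.
Lemma nrmi a : nrm ('i%C *: a) = nrm a. Proof. by rewrite /nrm nsqi. Qed.

Lemma nrmZ r a : nrm (r%:C *: a) = `|r| * nrm a.
Proof. by rewrite /nrm nsqZ sqrtrM ?sqr_ge0// sqrtr_sqr. Qed.

Lemma nrm0 : nrm 0 = 0. Proof. by rewrite /nrm nsq0 sqrtr0. Qed.

Lemma nrm1 : nrm 1 = 1.
Proof. by rewrite /nrm /nsq star1 mulr1 /retr (tau1 tsP) /= sqrtr1. Qed.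

Lemma retr_CS a b : `|retr (a * b)| <= nrm a * nrm b.
Proof.
rewrite -[leLHS]sqrtr_sqr -sqrtrM ?nsq_ge0// ler_wsqrtr//.
by rewrite -{1}(starK tsP a) -(nsq_star a) retr_CS2.
Qed.

Lemma nrmD a b : nrm (a + b) <= nrm a + nrm b.
Proof.
rewrite -(@ler_pXn2r _ 2) ?nnegrE ?addr_ge0 ?nrm_ge0// nrm_sqr sqrrD !nrm_sqr.
rewrite nsq_expand -mulr_natl.
have := retr_CS (star a) b; rewrite nrm_star => /(le_trans (ler_norm _)) h.
lra.
Qed.

Lemma nrm_le a K : 0 <= K -> (nrm a <= K) = (nsq a <= K ^+ 2).
Proof.
by move=> K0; rewrite -(@ler_pXn2r _ 2) ?nnegrE ?nrm_ge0// nrm_sqr.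
Qed.

(** Operator norm as seen by the trace: [w] acts on L2 by left and by right multiplication, so the
    vectors of the Hilbert space are not involved. *)
Definition opbound K w :=
  0 <= K /\ forall a, nrm (w * a) <= K * nrm a /\ nrm (a * w) <= K * nrm a.

Lemma opboundM K L w v : opbound K w -> opbound L v -> opbound (K * L) (w * v).
Proof.
move=> [K0 h] [L0 g]; split=> [|a]; first exact: mulr_ge0.
split.
  rewrite -mulrA; apply: le_trans (h _).1 _; rewrite -mulrA.
  by apply: ler_wpM2l => //; exact: (g _).1.
rewrite mulrA; apply: le_trans (g _).2 _; rewrite -mulrA mulrCA.
by apply: ler_wpM2l => //; exact: (h _).2.
Qed.

Lemma opboundD K L w v : opbound K w -> opbound L v -> opbound (K + L) (w + v).
Proof.
move=> [K0 h] [L0 g]; split=> [|a]; first exact: addr_ge0.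
rewrite mulrDl mulrDr; split; apply: le_trans (nrmD _ _) _;
  rewrite mulrDl; apply: lerD; [case: (h a)|case: (g a)|case: (h a)|case: (g a)];
  by [].
Qed.

Lemma opboundN K w : opbound K w -> opbound K (- w).
Proof. by move=> [K0 h]; split=> // a; rewrite mulNr mulrN !nrmN. Qed.

Lemma opboundi K w : opbound K w -> opbound K ('i%C *: w).
Proof.
by move=> [K0 h]; split=> // a; rewrite -scalerAl -scalerAr !nrmi.
Qed.

(** The involution is an L2 isometry and exchanges right multiplication by [w] with left
    multiplication by [star w]. *)
Lemma opbound_half K w : 0 <= K ->
  (forall a, nsq (w * a) <= K ^+ 2 * nsq a) ->
  (forall a, nsq (star w * a) <= K ^+ 2 * nsq a) -> opbound K w.
Proof.
move=> K0 h h'; split=> // a; split.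
  by rewrite nrm_le ?mulr_ge0 ?nrm_ge0// exprMn nrm_sqr.
rewrite -nrm_star (starM tsP) nrm_le ?mulr_ge0 ?nrm_ge0// exprMn nrm_sqr.
by rewrite -(nsq_star a).
Qed.

Lemma opbound_star K w : opbound K w -> opbound K (star w).
Proof.
move=> [K0 h]; split=> // a; have [h1 h2] := h (star a).
rewrite -nrm_star (starM tsP) (starK tsP) -[nrm (a * _)]nrm_star.
by rewrite (starM tsP) (starK tsP) -(nrm_star a).
Qed.

Lemma opbound_unitary w : star w * w = 1 -> w * star w = 1 -> opbound 1 w.
Proof.
move=> h1 h2; apply: opbound_half => // a;
  rewrite expr1n mul1r /nsq (starM tsP) ?(starK tsP) -mulrA.
  by rewrite (mulrA (star w)) h1 mul1r.
by rewrite (mulrA w) h2 mul1r.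
Qed.

Lemma opbound_proj w : star w = w -> w * w = w -> opbound 1 w.
Proof.
(* [1 - w] is a projection too, and [nsq ((1 - w) * a)] is the difference of the two sides. *)
move=> h1 h2; have e a : nsq (w * a) <= 1 ^+ 2 * nsq a.
  rewrite expr1n mul1r; have := nsq_ge0 ((1 - w) * a).
  rewrite /nsq !(starM tsP) starB star1 h1 -!mulrA !(mulrA (1 - w)).
  have -> : (1 - w) * (1 - w) = 1 - w.
    by rewrite mulrBr mulr1 mulrBl mul1r h2 subrr subr0.
  by rewrite mulrBl mul1r mulrBr retrB (mulrA w) h2 subr_ge0.
by apply: opbound_half => //; rewrite h1.
Qed.

Lemma opbound1 : opbound 1 (1 : T).
Proof. by split=> [|a]; rewrite ?ler01// !mul1r mulr1. Qed.

Lemma nrm_opbound K w : opbound K w -> nrm w <= K.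
Proof. by move=> [_ /(_ 1)[+ _]]; rewrite nrm1 !mulr1. Qed.

End TracialStar.

(** * Calculus of orders of magnitude in L2 norm and operator norm *)

Section Orders.
Context {R : realType} {T : algType R[i]} (star : T -> T) (tau : T -> R[i]).
Hypothesis tsP : tracial_star star tau.
Context {I : Type} (s : I -> R).
Hypothesis s01 : forall i, 0 <= s i <= 1.
Implicit Types (f g : I -> T) (x y : I -> R) (k l : nat).

Local Notation retr := (retr tau).
Local Notation nrm := (nrm star tau).
Local Notation opbound := (opbound star tau).

(* Uniform bounds of order [s ^+ k] for the L2 norm, for the operator norm and
   for real numbers. *)
Definition OL k f := exists2 K, 0 <= K & forall i, nrm (f i) <= K * s i ^+ k.
Definition OB k f := exists2 K, 0 <= K & forall i, opbound (K * s i ^+ k) (f i).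
Definition OR k x := exists2 K, 0 <= K & forall i, `|x i| <= K * s i ^+ k.

Let s0 i k : 0 <= s i ^+ k.
Proof. by rewrite exprn_ge0//; case/andP: (s01 i). Qed.

Let sle i k l : (l <= k)%N -> s i ^+ k <= s i ^+ l.
Proof. by case/andP: (s01 i) => h1 h2 /subnK <-; rewrite exprD ler_piMl ?s0 ?exprn_ile1. Qed.

Lemma OL_le k l f : (l <= k)%N -> OL k f -> OL l f.
Proof.
move=> lk [K K0 h]; exists K => // i; apply: le_trans (h i) _.
by apply: ler_wpM2l => //; exact: sle.
Qed.

Lemma OL_eq k f g : OL k g -> f =1 g -> OL k f.
Proof. by move=> [K K0 h] e; exists K => // i; rewrite e. Qed.

Lemma OB_eq k f g : OB k g -> f =1 g -> OB k f.
Proof. by move=> [K K0 h] e; exists K => // i; rewrite e. Qed.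

Lemma OR_eq k x y : OR k y -> x =1 y -> OR k x.
Proof. by move=> [K K0 h] e; exists K => // i; rewrite e. Qed.

Lemma OLD k f g : OL k f -> OL k g -> OL k (fun i => f i + g i).
Proof.
move=> [K K0 hK] [L L0 hL]; exists (K + L); first exact: addr_ge0.
by move=> i; apply: le_trans (nrmD tsP _ _) _; rewrite mulrDl lerD.
Qed.

Lemma OBD k f g : OB k f -> OB k g -> OB k (fun i => f i + g i).
Proof.
move=> [K K0 hK] [L L0 hL]; exists (K + L); first exact: addr_ge0.
by move=> i; rewrite mulrDl; apply: opboundD.
Qed.

Lemma ORD k x y : OR k x -> OR k y -> OR k (fun i => x i + y i).
Proof.
move=> [K K0 hK] [L L0 hL]; exists (K + L); first exact: addr_ge0.
by move=> i; apply: le_trans (ler_normD _ _) _; rewrite mulrDl lerD.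
Qed.

Lemma OLN k f : OL k f -> OL k (fun i => - f i).
Proof. by move=> [K K0 h]; exists K => // i; rewrite (nrmN tsP). Qed.

Lemma OBN k f : OB k f -> OB k (fun i => - f i).
Proof. by move=> [K K0 h]; exists K => // i; apply: opboundN. Qed.

Lemma OLB k f g : OL k f -> OL k g -> OL k (fun i => f i - g i).
Proof. by move=> hf hg; apply: OLD => //; exact: OLN. Qed.

Lemma OBB k f g : OB k f -> OB k g -> OB k (fun i => f i - g i).
Proof. by move=> hf hg; apply: OBD => //; exact: OBN. Qed.

Lemma OL_star k f : OL k f -> OL k (fun i => star (f i)).
Proof. by move=> [K K0 h]; exists K => // i; rewrite (nrm_star tsP). Qed.

Lemma OB_star k f : OB k f -> OB k (fun i => star (f i)).
Proof. by move=> [K K0 h]; exists K => // i; apply: opbound_star. Qed.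

Lemma OBM k l f g : OB k f -> OB l g -> OB (k + l) (fun i => f i * g i).
Proof.
move=> [K K0 hK] [L L0 hL]; exists (K * L); first exact: mulr_ge0.
by move=> i; rewrite exprD mulrACA; apply: opboundM.
Qed.

Lemma OBLM k l f g : OB k f -> OL l g -> OL (k + l) (fun i => f i * g i).
Proof.
move=> [K K0 hK] [L L0 hL]; exists (K * L); first exact: mulr_ge0.
move=> i; rewrite exprD mulrACA; have [Ks0 h] := hK i.
by apply: le_trans (h _).1 _; apply: ler_wpM2l.
Qed.

Lemma OLBM k l f g : OL k f -> OB l g -> OL (k + l) (fun i => f i * g i).
Proof.
move=> [K K0 hK] [L L0 hL]; exists (K * L); first exact: mulr_ge0.
move=> i; rewrite exprD mulrACA [X in _ <= X]mulrC; have [Ks0 h] := hL i.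
by apply: le_trans (h _).2 _; apply: ler_wpM2l.
Qed.

Lemma OBL k f : OB k f -> OL k f.
Proof. by move=> [K K0 h]; exists K => // i; apply: nrm_opbound. Qed.

(** By Cauchy-Schwarz; this is the only product rule that accepts two factors known in L2 norm
    only. *)
Lemma OR_retr k l f g : OL k f -> OL l g -> OR (k + l) (fun i => retr (f i * g i)).
Proof.
move=> [K K0 hK] [L L0 hL]; exists (K * L); first exact: mulr_ge0.
move=> i; rewrite exprD mulrACA; apply: le_trans (retr_CS tsP _ _) _.
by apply: ler_pM => //; apply: nrm_ge0.
Qed.

Lemma OLZ k l x f : OR k x -> OL l f -> OL (k + l) (fun i => (x i)%:C *: f i).
Proof.
move=> [K K0 hK] [L L0 hL]; exists (K * L); first exact: mulr_ge0.
move=> i; rewrite exprD mulrACA (nrmZ tsP).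
by apply: ler_pM => //; apply: nrm_ge0.
Qed.

Lemma ORM k l x y : OR k x -> OR l y -> OR (k + l) (fun i => x i * y i).
Proof.
move=> [K K0 hK] [L L0 hL]; exists (K * L); first exact: mulr_ge0.
by move=> i; rewrite exprD mulrACA normrM; apply: ler_pM.
Qed.

Lemma OR0 k : OR k (fun=> 0).
Proof. by exists 0 => // i; rewrite normr0 mul0r. Qed.

Lemma OR_cst c : OR 0 (fun=> c).
Proof. by exists `|c| => // i; rewrite expr0 mulr1. Qed.

Lemma ORs k : OR k (fun i => s i ^+ k).
Proof. by exists 1 => // i; rewrite mul1r ger0_norm. Qed.

Lemma OR_sum (J : Type) (r : seq J) (P : pred J) k (x : J -> I -> R) :
  (forall j, OR k (x j)) -> OR k (fun i => \sum_(j <- r | P j) x j i).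
Proof.
move=> h; elim: r => [|j r IH].
  by have [K K0 hK] := OR0 k; exists K => // i; rewrite big_nil.
have [K K0 hK] : OR k (fun i => (if P j then x j i else 0)
                        + \sum_(j <- r | P j) x j i).
  by apply: ORD IH; case: (P j) => //; exact: OR0.
exists K => // i; apply: le_trans (hK i); rewrite big_cons.
by case: (P j) => //; rewrite add0r.
Qed.

Lemma OB0 k : OB k (fun=> 0).
Proof.
by exists 0 => // i; rewrite mul0r; split=> // a; rewrite mul0r mulr0 (nrm0 tsP) mul0r.
Qed.

Lemma OL_sum (J : Type) (r : seq J) (P : pred J) k (f : J -> I -> T) :
  (forall j, OL k (f j)) -> OL k (fun i => \sum_(j <- r | P j) f j i).
Proof.
move=> h; elim: r => [|j r IH].
  by have [K K0 hK] := OBL (OB0 k); exists K => // i; rewrite big_nil.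
have [K K0 hK] : OL k (fun i => (if P j then f j i else 0)
                        + \sum_(j <- r | P j) f j i).
  by apply: OLD IH; case: (P j) => //; apply: OBL; exact: OB0.
exists K => // i; apply: le_trans (hK i); rewrite big_cons.
by case: (P j) => //; rewrite add0r.
Qed.

Lemma OB_exp f n : OB 0 f -> OB 0 (fun i => f i ^+ n).
Proof.
move=> h; elim: n => [|n IH].
  exists 1 => // i; rewrite expr0 mul1r; exact: opbound1.
have [K K0 hK] := OBM h IH; exists K => // i; rewrite exprS; exact: hK.
Qed.

End Orders.

(** * Identities in rings behind the expansion of words *)

(** With [S] the partial sums of [a], row [i] is [S i + S N - S (N - i)], and the reflection of [i]
    to [N - i] cancels the outer terms. Here [j < i] are the places of the two changed letters of a
    cyclic word, and the two arguments of [a] count the letters in the two arcs between them. *)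
Lemma sum_sum_reflect (V : comPzRingType) (a : nat -> V) N :
  \sum_(i < N.+1) \sum_(j < i) (a (i - j.+1)%N + a (N - i + j)%N) =
  N.+1%:R * \sum_(k < N) a k.
Proof.
pose S n := \sum_(k < n) a k.
have lo i : \sum_(j < i) a (i - j.+1)%N = S i.
  by rewrite [RHS](reindex_inj rev_ord_inj).
have hi i : (i <= N)%N -> \sum_(j < i) a (N - i + j)%N = S N - S (N - i)%N.
  elim: i => [|i IH] iN; first by rewrite big_ord0 subn0 subrr.
  rewrite big_ord_recl /= addn0; under eq_bigr do
    rewrite /bump /= addnCA add1n -addSn -subSn// subSS.
  rewrite IH ?(ltnW iN)// -[in S (N - i)%N](prednK (n := (N - i)%N)) ?subn_gt0//.
  by rewrite -subnS /S big_ord_recr /=; ring.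
transitivity (\sum_(i < N.+1) (S i - S (N - i)%N) + \sum_(i < N.+1) S N).
  rewrite -big_split /=; apply: eq_bigr => i _.
  by rewrite big_split /= lo hi -1?ltnS//; ring.
rewrite sumr_const card_ord big_split /= sumrN.
rewrite [X in - X](reindex_inj rev_ord_inj) /=.
under [X in - X]eq_bigr do rewrite subSS subKn -1?ltnS//.
by rewrite subrr add0r mulr_natl.
Qed.

Lemma expr_sub (V : pzRingType) (x y : V) n :
  y ^+ n - x ^+ n = \sum_(i < n) y ^+ i * (y - x) * x ^+ (n - i.+1).
Proof.
elim: n => [|n IH]; first by rewrite big_ord0 subrr.
rewrite big_ord_recr /= subnn mulr1.
transitivity ((y ^+ n - x ^+ n) * x + y ^+ n * (y - x)).
  by rewrite mulrBl mulrBr -!exprSr [RHS]addrC addrA subrK.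
rewrite IH mulr_suml; congr (_ + _); apply: eq_bigr => i _.
by rewrite -mulrA -exprSr subSS -subSn.
Qed.

Lemma sandwich_sub (V : pzRingType) (y d q y' d' : V) :
  (y + d) * q * (y' + d') - y * q * y' = d * q * y' + y * q * d' + d * q * d'.
Proof.
rewrite !mulrDl !mulrDr [LHS]addrC !addrA addNr add0r.
by congr (_ + _); rewrite addrC.
Qed.

(** For a skew-adjoint [w], [y' * - w + e'] is the adjoint of [w * y + e]: the two one-sided changes
    of [y * q * y'] add up to a commutator with [w]. *)
Lemma sandwich_commutator (V : pzRingType) (w y e q y' e' : V) :
  (w * y + e) * q * y' + y * q * (y' * - w + e')
    - (w * (y * q * y') - y * q * y' * w) = e * q * y' + y * q * e'.
Proof.
rewrite !mulrDl !mulrDr !mulrN !mulrA opprB [LHS]addrC !addrA subrK.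
rewrite -!addrA addrCA !addrA; congr (_ + _).
by rewrite addrK.
Qed.

(** Up to a cyclic rotation each term has the shape [w * _ * w * _], which is what freeness
    evaluates. *)
Lemma commutator_mul (V : pzRingType) (w u a b : V) :
  (w * u - u * w) * a * (w * u - u * w) * b =
  w * (u * a) * w * (u * b) - w * (u * a * u) * w * b
  - u * (w * a * w * (u * b)) + u * (w * (a * u) * w * b).
Proof. by rewrite !mulrBl !mulrBr !mulrBl !mulrA opprB !addrA addrAC. Qed.

(** * Second-order expansion of the moments, with [S i] the past of the instant [i] *)

Section SecondOrder.
Context {R : realType} {T : algType R[i]} (star : T -> T) (tau : T -> R[i]).
Hypothesis tsP : tracial_star star tau.
Context {I : Type} (s : I -> R).
Hypothesis s01 : forall i, 0 <= s i <= 1.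
Context (Y Y' W E : I -> T) (P Q : T) (theta : R) (S : I -> T -> Prop).

Local Notation retr := (retr tau).
Local Notation OL := (OL star tau s).
Local Notation OB := (OB star tau s).
Local Notation OR := (OR s).

Hypothesis SM : forall i a b, S i a -> S i b -> S i (a * b).
Hypothesis S_star : forall i a, S i a -> S i (star a).
Hypothesis SY : forall i, S i (Y i).
Hypothesis SP : forall i, S i P.
Hypothesis SQ : forall i, S i Q.
Hypothesis YY : forall i, star (Y i) * Y i = 1 /\ Y i * star (Y i) = 1.
Hypothesis YY' : forall i, star (Y' i) * Y' i = 1 /\ Y' i * star (Y' i) = 1.
Hypothesis starP : star P = P.
Hypothesis starQ : star Q = Q.
Hypothesis PP : P * P = P.
Hypothesis QQ : Q * Q = Q.
Hypothesis tauQ : tau Q = theta%:C.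
Hypothesis Y'E : forall i,
  Y' i = Y i + W i * Y i - (s i ^+ 2 / 2)%:C *: Y i + E i.
Hypothesis OBW : OB 1 W.
Hypothesis starW : forall i, star (W i) = - W i.
Hypothesis OLE : OL 2 E.
Hypothesis ORE : forall b, (forall i, S i (b i)) -> OB 0 b ->
  OR 3 (fun i => retr (E i * b i)).
Hypothesis tauW : forall i a, S i a -> tau (W i * a) = 0.
Hypothesis tauWW : forall i a b, S i a -> S i b ->
  tau (W i * a * W i * b) = - (s i ^+ 2)%:C * (tau a * tau b).

(* Locked, so that rewriting with ring laws does not look inside them. *)
Let U i := locked (Y i * Q * star (Y i)).
Let U' i := locked (Y' i * Q * star (Y' i)).
Let A k i := locked ((P * U i) ^+ k * P).
Let M k i := retr (A k i).

Let UE i : U i = Y i * Q * star (Y i). Proof. by rewrite /U -lock. Qed.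
Let U'E i : U' i = Y' i * Q * star (Y' i). Proof. by rewrite /U' -lock. Qed.
Let AE k i : A k i = (P * U i) ^+ k * P. Proof. by rewrite /A -lock. Qed.

Let SU i : S i (U i).
Proof. by rewrite UE; apply: (SM (SM (SY i) (SQ i))); exact: S_star. Qed.

Let SA k i : S i (A k i).
Proof.
elim: k => [|k]; rewrite !AE ?mul1r// => IH.
by rewrite exprS -mulrA; apply: SM => //; apply: SM.
Qed.

Let OBP : OB 0 (fun=> P).
Proof. by exists 1 => // i; rewrite mulr1; exact: opbound_proj. Qed.
Let OBQ : OB 0 (fun=> Q).
Proof. by exists 1 => // i; rewrite mulr1; exact: opbound_proj. Qed.
Let OBY : OB 0 Y.
Proof. by exists 1 => // i; rewrite mulr1; have [? ?] := YY i; exact: opbound_unitary. Qed.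
Let OBY' : OB 0 Y'.
Proof. by exists 1 => // i; rewrite mulr1; have [? ?] := YY' i; exact: opbound_unitary. Qed.
Let OBU : OB 0 U.
Proof. exact: (OB_eq (OBM (OBM OBY OBQ) (OB_star tsP OBY)) UE). Qed.
Let OBU' : OB 0 U'.
Proof. exact: (OB_eq (OBM (OBM OBY' OBQ) (OB_star tsP OBY')) U'E). Qed.
Let OBA k : OB 0 (A k).
Proof. exact: (OB_eq (OBM (OB_exp k (OBM OBP OBU)) OBP) (AE k)). Qed.

Let UU i : U i * U i = U i.
Proof.
rewrite UE -!mulrA (mulrA (star (Y i))); have [-> _] := YY i.
by rewrite mul1r (mulrA Q) QQ.
Qed.

Let starU i : star (U i) = U i.
Proof. by rewrite UE !(starM tsP) (starK tsP) starQ !mulrA. Qed.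

(** The [A k] multiply like the powers of the compression [P * U * P], the power of order 0 being
    [P]. *)
Let AS k i : A k.+1 i = P * U i * A k i.
Proof. by rewrite !AE exprS mulrA. Qed.

Let AP k i : A k i * P = A k i. Proof. by rewrite AE -mulrA PP. Qed.

Let PA k i : P * A k i = A k i.
Proof. by case: k => [|k]; rewrite AE ?expr0 ?mul1r// exprS !mulrA PP. Qed.

Let ASr k i : A k.+1 i = A k i * U i * P.
Proof. by rewrite !AE exprSr !mulrA. Qed.

Let starA k i : star (A k i) = A k i.
Proof.
elim: k => [|k IH]; first by rewrite AE mul1r.
by rewrite AS (starM tsP (P * U i)) (starM tsP P) starU starP IH -AS ASr mulrA.
Qed.

Let tau_sa a : star a = a -> tau a = (retr a)%:C.
Proof.
move=> sa; have := tau_star tsP a; rewrite sa /retr.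
by case: (tau a) => u v [] /= e; congr (_ +i* _)%C; lra.
Qed.

Let tauA k i : tau (A k i) = (M k i)%:C.
Proof. exact: tau_sa. Qed.

Let tauUA k i : tau (U i * A k i) = (M k.+1 i)%:C.
Proof. by rewrite -tauA AS -(mulrA P) (tau_comm tsP P) -(mulrA (U i)) AP. Qed.

Let tauAU k i : tau (A k i * U i) = (M k.+1 i)%:C.
Proof. by rewrite (tau_comm tsP) tauUA. Qed.

Let tauU i : tau (U i) = theta%:C.
Proof.
rewrite -tauQ UE (tau_comm tsP) mulrA; have [-> _] := YY i; by rewrite mul1r.
Qed.

Let h i := s i ^+ 2.
Let dY i := locked (Y' i - Y i).
Let E' i := locked (E i - (h i / 2)%:C *: Y i).

Let dYE i : dY i = Y' i - Y i. Proof. by rewrite /dY -lock. Qed.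
Let E'E i : E' i = E i - (h i / 2)%:C *: Y i. Proof. by rewrite /E' -lock. Qed.

Let dYE' i : dY i = W i * Y i + E' i.
Proof.
rewrite dYE Y'E E'E [LHS]addrC !addrA addNr add0r -[LHS]addrA.
by rewrite [_ + E i]addrC addrA.
Qed.

Let OLE' : OL 2 E'.
Proof.
apply: OL_eq E'E; apply: (OLB tsP OLE).
have h0 : OR 2 (fun i => h i / 2) by apply: (ORM (k := 2) (l := 0)); [exact: ORs|exact: OR_cst].
exact: (OLZ tsP h0 (OBL tsP OBY)).
Qed.

Let OBdY : OB 0 dY.
Proof. exact: (OB_eq (OBB tsP OBY' OBY) dYE). Qed.

Let OLdY : OL 1 dY.
Proof.
apply: OL_eq dYE'; apply: (OLD tsP); last by apply: (OL_le s01) OLE'.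
exact: (OBL tsP (OBM OBW OBY)).
Qed.

Let dU i := locked (U' i - U i).

Let dUE i : dU i = U' i - U i. Proof. by rewrite /dU -lock. Qed.

Let dU_split i : dU i =
  dY i * Q * star (Y i) + Y i * Q * star (dY i) + dY i * Q * star (dY i).
Proof.
rewrite dUE U'E UE (_ : Y' i = Y i + dY i); last by rewrite dYE addrC subrK.
by rewrite (starD tsP) sandwich_sub.
Qed.

(** The part of [dU] linear in [W]; unlike [dU], it is of order 1 in operator norm. *)
Let K i := locked (W i * U i - U i * W i).

Let KE i : K i = W i * U i - U i * W i. Proof. by rewrite /K -lock. Qed.

Let OBK : OB 1 K.
Proof. exact: (OB_eq (OBB tsP (OBM OBW OBU) (OBM OBU OBW)) KE). Qed.

Let rho i := locked (dU i - K i).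

Let rhoE i : rho i = dU i - K i. Proof. by rewrite /rho -lock. Qed.

Let rho_split i : rho i = E' i * Q * star (Y i) + Y i * Q * star (E' i)
   + dY i * Q * star (dY i).
Proof.
rewrite rhoE dU_split addrAC; congr (_ + _).
by rewrite dYE' (starD tsP) (starM tsP (W i)) starW KE UE sandwich_commutator.
Qed.

Let OLrho : OL 2 rho.
Proof.
have h1 : OL 2 (fun i => E' i * Q * star (Y i)).
  exact: (OLBM (OLBM OLE' OBQ) (OB_star tsP OBY)).
have h2 : OL 2 (fun i => Y i * Q * star (E' i)).
  exact: (OBLM (OBM OBY OBQ) (OL_star tsP OLE')).
have h3 : OL 2 (fun i => W i * Y i * Q * star (W i * Y i)).
  apply: (OBL tsP).
  exact: (OBM (OBM (OBM OBW OBY) OBQ) (OB_star tsP (OBM OBW OBY))).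
have h4 : OL 2 (fun i => W i * Y i * Q * star (E' i)).
  apply: (OL_le s01 (k := 3)) => //.
  exact: (OBLM (OBM (OBM OBW OBY) OBQ) (OL_star tsP OLE')).
have h5 : OL 2 (fun i => E' i * Q * star (dY i)).
  exact: (OLBM (OLBM OLE' OBQ) (OB_star tsP OBdY)).
apply: OL_eq (OLD tsP (OLD tsP h1 h2) (OLD tsP (OLD tsP h3 h4) h5)) _ => i.
rewrite rho_split; congr (_ + _).
by rewrite -(mulrDr (W i * Y i * Q)) -(starD tsP) -dYE' -!mulrDl -dYE'.
Qed.

Let OLdU : OL 1 dU.
Proof.
apply: OL_eq (OLD tsP (OL_le s01 (isT : 1 <= 2)%N OLrho) (OBL tsP OBK)) _ => i.
by rewrite rhoE subrK.
Qed.

(** The drift [- h / 2] of [dY] and that of its adjoint together give [- h * M k.+1]; the square of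
    [W], surrounding [U] of trace [theta], gives [h * theta * M k]. *)
Let first_order k : OR 3 (fun i =>
  retr (dU i * A k i) - h i * (theta * M k i - M k.+1 i)).
Proof.
have h1 : OR 3 (fun i => retr (E i * (Q * star (Y i) * A k i))).
  apply: ORE => [i|].
    by apply: SM => //; apply: SM => //; exact: S_star.
  exact: (OBM (OBM OBQ (OB_star tsP OBY)) (OBA k)).
have h2 : OR 3 (fun i => retr (W i * Y i * Q * (star (E' i) * A k i))).
  apply: (OR_retr tsP (k := 1) (l := 2)).
    exact: (OBL tsP (OBM (OBM OBW OBY) OBQ)).
  exact: (OLBM (OL_star tsP OLE') (OBA k)).
have h3 : OR 3 (fun i => retr (E' i * Q * (star (dY i) * A k i))).
  apply: (OR_retr tsP (k := 2) (l := 1)); first exact: (OLBM OLE' OBQ).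
  exact: (OLBM (OL_star tsP OLdY) (OBA k)).
apply: OR_eq (ORD (ORD h1 h1) (ORD h2 h3)) _ => i.
have eM a : S i a -> retr (W i * a) = 0 by move=> Sa; rewrite /retr tauW.
have e1 : retr (dY i * Q * star (Y i) * A k i) =
    retr (E i * (Q * star (Y i) * A k i)) - h i / 2 * M k.+1 i.
  rewrite dYE' E'E !mulrDl !mulNr !(retrD tsP) (retrN tsP).
  rewrite -!mulrA eM ?add0r; last first.
    do ?[apply: SM => //]; exact: S_star.
  rewrite -!scalerAl (retrZ tsP) !mulrA -UE; congr (_ - _ * _).
  by rewrite /retr tauUA.
have e2 : retr (Y i * Q * star (dY i) * A k i) = retr (dY i * Q * star (Y i) * A k i).
  rewrite -(retr_star tsP) !(starM tsP) (starK tsP) starA starQ.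
  by rewrite (retr_comm tsP) !mulrA.
(* The Itô term: [- W * U * W * A k] has trace [h * tau U * tau (A k)], and the remaining products
   contain [E'] together with a factor of order 1. *)
have e3 : retr (dY i * Q * star (dY i) * A k i) =
    h i * theta * M k i + (retr (W i * Y i * Q * (star (E' i) * A k i))
      + retr (E' i * Q * (star (dY i) * A k i))).
  rewrite {1}dYE' (mulrDl (W i * Y i)) (mulrDl (_ * Q)) (mulrDl (_ * star _)).
  rewrite (retrD tsP) {1}dYE' (starD tsP) (mulrDr (_ * Q)) (mulrDl (_ * star _)).
  rewrite (retrD tsP) -!addrA -!mulrA; congr (_ + _).
  rewrite (starM tsP (W i)) starW.
  have -> : W i * (Y i * (Q * (star (Y i) * - W i * A k i)))
    = - (W i * U i * W i * A k i) by rewrite !mulrN !mulNr !mulrN UE !mulrA.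
  rewrite (retrN tsP) /retr tauWW// tauU tauA mulNr -!rmorphM -rmorphN /=.
  by rewrite opprK expr2 -mulrA.
rewrite dU_split !mulrDl !(retrD tsP) e2 e1 e3 /h; by field.
Qed.

(** Each [dU] may be replaced by the commutator [K] at the cost of order 3. The idempotence of [U]
    then turns the trace of [U * A k * U] into [M k.+1], which is why differences of consecutive
    moments appear. *)
Let second_order k l : OR 3 (fun i => retr (dU i * A k i * dU i * A l i)
  - h i * (M l.+1 i * (M k i - M k.+1 i) + M k.+1 i * (M l i - M l.+1 i))).
Proof.
have h1 : OR 3 (fun i => retr (rho i * (A k i * dU i * A l i))).
  apply: (OR_retr tsP (k := 2) (l := 1)) => //.
  exact: (OLBM (OBLM (OBA k) OLdU) (OBA l)).
have h2 : OR 3 (fun i => retr (K i * A k i * (rho i * A l i))).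
  apply: (OR_retr tsP (k := 1) (l := 2)).
    exact: (OBL tsP (OBM OBK (OBA k))).
  exact: (OLBM OLrho (OBA l)).
apply: OR_eq (ORD h1 h2) _ => i.
have -> : retr (dU i * A k i * dU i * A l i) =
    retr (rho i * (A k i * dU i * A l i)) + (retr (K i * A k i * (rho i * A l i))
    + retr (K i * A k i * K i * A l i)).
  rewrite -!(retrD tsP); congr (retr _).
  rewrite -{1}[dU i](subrK (K i)) -rhoE !mulrDl !mulrA; congr (_ + _).
  by rewrite -{1}[dU i](subrK (K i)) -rhoE !mulrDr !mulrDl.
suff -> : retr (K i * A k i * K i * A l i) =
   h i * (M l.+1 i * (M k i - M k.+1 i) + M k.+1 i * (M l i - M l.+1 i)) by ring.
rewrite KE commutator_mul !(retrD tsP) !(retrN tsP).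
rewrite (retr_comm tsP (U i) (W i * A k i * W i * _)).
rewrite -(mulrA (W i * A k i * W i)) (retr_comm tsP (U i) (_ * A l i)).
rewrite -(mulrA (W i * (A k i * U i) * W i)).
rewrite /retr !tauWW; try by do ?[exact: SU|exact: SA|apply: SM].
have UAU j : tau (U i * A j i * U i) = (M j.+1 i)%:C.
  by rewrite (tau_comm tsP) mulrA UU tauUA.
rewrite !UAU !tauUA !tauAU !tauA -!rmorphM -!rmorphN -!rmorphM /= -/(h i).
by ring.
Qed.

Let A' k i := locked ((P * U' i) ^+ k * P).
Let A'E k i : A' k i = (P * U' i) ^+ k * P. Proof. by rewrite /A' -lock. Qed.

Let D k i := locked (A' k i - A k i).
Let DE k i : D k i = A' k i - A k i. Proof. by rewrite /D -lock. Qed.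

Let AA k l i : A k i * A l i = A (k + l)%N i.
Proof. by rewrite (AE k) -(mulrA _ P) PA !AE exprD mulrA. Qed.

(** In the telescoped sum the new letters all stand to the left of the changed one, so a second
    expansion has only the factor [A' j] to treat. *)
Let D_sum k i : D k i = \sum_(j < k) A' j i * dU i * A (k - j.+1)%N i.
Proof.
rewrite DE A'E AE -mulrBl expr_sub mulr_suml; apply: eq_bigr => j _.
by rewrite -mulrBr dUE A'E AE !mulrA.
Qed.

Let OBA' k : OB 0 (A' k).
Proof. exact: (OB_eq (OBM (OB_exp k (OBM OBP OBU')) OBP) (A'E k)). Qed.

Let OBD k : OB 0 (D k).
Proof. exact: (OB_eq (OBB tsP (OBA' k) (OBA k)) (DE k)). Qed.

Let OLD k : OL 1 (D k).
Proof.
apply: OL_eq (D_sum k); apply: (OL_sum tsP) => j.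
exact: (OLBM (OBLM (OBA' j) OLdU) (OBA _)).
Qed.

(** Three factors of order 1 in L2 cannot be bounded together. Both [dU] are split into [K + rho],
    so that in every term only two factors are measured in L2; [D] is used either as bounded in
    operator norm or as of order 1 in L2. *)
Let third_order j k l :
  OR 3 (fun i => retr (D j i * dU i * A k i * dU i * A l i)).
Proof.
have h1 : OR 3 (fun i => retr (D j i * rho i * (A k i * dU i * A l i))).
  apply: (OR_retr tsP (k := 2) (l := 1)); first exact: (OBLM (OBD j) OLrho).
  exact: (OLBM (OBLM (OBA k) OLdU) (OBA l)).
have h2 : OR 3 (fun i => retr (D j i * K i * A k i * (rho i * A l i))).
  apply: (OR_retr tsP (k := 1) (l := 2)); last exact: (OLBM OLrho (OBA l)).
  exact: (OBL tsP (OBM (OBM (OBD j) OBK) (OBA k))).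
have h3 : OR 3 (fun i => retr (D j i * (K i * A k i * K i * A l i))).
  apply: (OR_retr tsP (k := 1) (l := 2)) => //.
  exact: (OBL tsP (OBM (OBM (OBM OBK (OBA k)) OBK) (OBA l))).
apply: OR_eq (ORD h1 (ORD h2 h3)) _ => i.
rewrite -!(retrD tsP); congr (retr _).
rewrite -{1}[dU i](subrK (K i)) -rhoE mulrDr !mulrDl !mulrA; congr (_ + _).
by rewrite -{1}[dU i](subrK (K i)) -rhoE !mulrDr !mulrDl.
Qed.

Lemma moment_holder n : OR 1 (fun i =>
  retr ((P * (Y' i * Q * star (Y' i))) ^+ n * P)
  - retr ((P * (Y i * Q * star (Y i))) ^+ n * P)).
Proof.
apply: OR_eq (OR_retr tsP (OBL tsP OBP) (OLD n)) _ => i.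
rewrite -UE -U'E -AE -A'E -(retrB tsP) -DE (retr_comm tsP) DE mulrBl AP.
by rewrite A'E -(mulrA _ P) PP.
Qed.

(** Telescoping is applied twice, through [A' = A + D] and then [D_sum] for [D]. This leaves words
    with one [dU], words with two, and words with two and a factor [D], which are of order 3. *)
Lemma moment_increment n :
  let m k i := retr ((P * (Y i * Q * star (Y i))) ^+ k * P) in
  OR 3 (fun i =>
    retr ((P * (Y' i * Q * star (Y' i))) ^+ n.+1 * P) - m n.+1 i
    - s i ^+ 2 * (n.+1%:R * (theta * m n i - m n.+1 i) + n.+1%:R *
        \sum_(k < n) m (n - k)%N i * (m k i - m k.+1 i))).
Proof.
move=> m; have mE k i : m k i = M k i by rewrite /m -UE -AE.
pose G i k := M (n - k)%N i * (M k i - M k.+1 i).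
have hT : OR 3 (fun i => \sum_(p < n.+1) \sum_(j < p)
    retr (D j i * dU i * A (p - j.+1)%N i * dU i * A (n - p)%N i)).
  by apply: OR_sum => p; apply: OR_sum => j; exact: third_order.
have h2 : OR 3 (fun i => \sum_(p < n.+1) \sum_(j < p)
    (retr (dU i * A (p - j.+1)%N i * dU i * A (n - p + j)%N i)
     - h i * (G i (p - j.+1)%N + G i (n - p + j)%N))).
  apply: OR_sum => p; apply: OR_sum => j.
  apply: OR_eq (second_order (p - j.+1) (n - p + j)) _ => i.
  have pn := ltn_ord p; have jp := ltn_ord j; rewrite ltnS in pn.
  rewrite /G (_ : (n - (p - j.+1) = (n - p + j).+1)%N); last by lia.
  by rewrite (_ : (n - (n - p + j) = (p - j.+1).+1)%N); last by lia.
have h1 : OR 3 (fun i => n.+1%:R *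
    (retr (dU i * A n i) - h i * (theta * M n i - M n.+1 i))).
  by apply: (ORM (k := 0) (l := 3)) (first_order n); exact: OR_cst.
apply: OR_eq (ORD h1 (ORD h2 hT)) _ => i.
under eq_bigr do rewrite !mE.
rewrite !mE -U'E -A'E -/(h i).
have -> : \sum_(k < n) M (n - k)%N i * (M k i - M k.+1 i) = \sum_(k < n) G i k by [].
rewrite -sum_sum_reflect.
have -> : retr (A' n.+1 i) - M n.+1 i = n.+1%:R * retr (dU i * A n i) +
   (\sum_(p < n.+1) \sum_(j < p)
    retr (dU i * A (p - j.+1)%N i * dU i * A (n - p + j)%N i) +
   \sum_(p < n.+1) \sum_(j < p)
    retr (D j i * dU i * A (p - j.+1)%N i * dU i * A (n - p)%N i)).
  rewrite /M -(retrB tsP) -DE D_sum (retr_sum tsP).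
  have -> x : n.+1%:R * x = \sum_(p < n.+1) x.
    by rewrite sumr_const card_ord mulr_natl.
  rewrite -!big_split /=; apply: eq_bigr => p _; rewrite subSS.
  have np : (n - p + p = n)%N by have := ltn_ord p; lia.
  (* By cyclicity the part with [A p] does not depend on [p], whence the [n.+1] copies of the
     first-order term. *)
  rewrite -[A' p i](subrK (A p i)) -DE !mulrDl (retrD tsP) [LHS]addrC.
  congr (_ + _); first by rewrite -mulrA (retr_comm tsP) -mulrA AA np.
  rewrite D_sum !mulr_suml (retr_sum tsP) -big_split /=; apply: eq_bigr => j _.
  rewrite -[A' j i](subrK (A j i)) -DE !mulrDl (retrD tsP) [LHS]addrC.
  congr (_ + _); rewrite -!(mulrA (A j i)) (retr_comm tsP) -!mulrA AA.
  by rewrite !mulrA.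
under [X in _ = _ + (X + _)]eq_bigr => p _ do rewrite sumrB -mulr_sumr.
by rewrite sumrB -mulr_sumr; ring.
Qed.

End SecondOrder.

(** * Integrals of step processes *)

Section Steps.
Context {R : realType} {T : algType R[i]} (star : T -> T) (tau : T -> R[i]).
Hypothesis tsP : tracial_star star tau.
Implicit Types (e f : R * R * T) (L : seq (R * R * T)) (Z : R -> T).
Local Notation retr := (retr tau).
Local Notation nsq := (nsq star tau).
Local Notation mu := (@lebesgue_measure R).

(* A list of triples [((s, u), a)] stands for the sum of the step processes
   equal to [a] on [s, u[ and to [0] elsewhere. *)
Definition step_val L (r : R) : T :=
  \sum_(e <- L) (if e.1.1 <= r < e.1.2 then e.2 else 0).

Definition step_int Z L : T := \sum_(e <- L) (Z e.1.2 - Z e.1.1) * e.2.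

Definition steps_in (p q : R) L :=
  {in L, forall e, [/\ p <= e.1.1, e.1.1 <= e.1.2 & e.1.2 <= q]}.

Definition overlap e f : R :=
  Num.max 0 (Num.min e.1.2 f.1.2 - Num.max e.1.1 f.1.1).

(** Squared norm of the step process in L2 of time with values in L2 of the trace, in Gram form: the
    intervals may overlap. *)
Definition step_form L : R :=
  \sum_(e <- L) \sum_(f <- L) overlap e f * retr (star e.2 * f.2).

Definition step_neg L := [seq (e.1, - e.2) | e <- L].

Lemma step_val_cat L L' r : step_val (L ++ L') r = step_val L r + step_val L' r.
Proof. by rewrite /step_val big_cat. Qed.

Lemma step_int_cat Z L L' : step_int Z (L ++ L') = step_int Z L + step_int Z L'.
Proof. by rewrite /step_int big_cat. Qed.

Lemma step_val_neg L r : step_val (step_neg L) r = - step_val L r.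
Proof.
rewrite /step_val big_map -sumrN; apply: eq_bigr => e _ /=.
by case: ifP; rewrite // oppr0.
Qed.

Lemma step_int_neg Z L : step_int Z (step_neg L) = - step_int Z L.
Proof.
by rewrite /step_int big_map -sumrN; apply: eq_bigr => e _ /=; rewrite mulrN.
Qed.

Lemma steps_in_cat p q L L' :
  steps_in p q L -> steps_in p q L' -> steps_in p q (L ++ L').
Proof. by move=> h h' e; rewrite mem_cat => /orP[/h|/h']. Qed.

Lemma steps_in_neg p q L : steps_in p q L -> steps_in p q (step_neg L).
Proof. by move=> h e /mapP[f /h ? ->]. Qed.

(** Projection onto [[p, q]] when [p <= q]; intervals that miss [[p, q]] collapse to a point and
    drop out of step integrals. *)
Definition clip (p q x : R) := Num.max p (Num.min q x).

Definition step_clip p q L := [seq ((clip p q e.1.1, clip p q e.1.2), e.2) | e <- L].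

Lemma clip_ge p q x : p <= clip p q x.
Proof. by rewrite /clip le_max lexx. Qed.

Lemma clip_le p q x : p <= q -> clip p q x <= q.
Proof. by move=> pq; rewrite /clip ge_max pq ge_min lexx. Qed.

Lemma clip_mono p q x y : x <= y -> clip p q x <= clip p q y.
Proof.
by move=> xy; rewrite ge_max !le_max lexx /= le_min !ge_min lexx xy !orbT.
Qed.

Lemma steps_in_clip p q p' q' L : p <= q ->
  steps_in p' q' L -> steps_in p q (step_clip p q L).
Proof.
move=> pq h e /mapP[f /h[_ h2 _] ->] /=.
by split; [exact: clip_ge|exact: clip_mono|exact: clip_le].
Qed.

Lemma step_val_clip p q L r : p <= r < q ->
  step_val (step_clip p q L) r = step_val L r.
Proof.
move=> /andP[pr rq]; rewrite /step_val big_map; apply: eq_bigr => e _ /=.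
congr (if _ then _ else _); congr (_ && _).
  by rewrite /clip ge_max pr /= ge_min leNgt rq.
by rewrite /clip lt_max ltNge pr /= lt_min rq.
Qed.

Lemma step_int_clip Z p q L : steps_in p q L ->
  step_int Z (step_clip p q L) = step_int Z L.
Proof.
move=> h; rewrite /step_int big_map big_seq_cond [RHS]big_seq_cond.
apply: eq_bigr => e /andP[/h[h1 h2 h3] _] /=.
have ce x : p <= x -> x <= q -> clip p q x = x.
  by move=> px xq; rewrite /clip (min_idPr xq) (max_idPr px).
by rewrite !ce ?(le_trans h1)// (le_trans h2).
Qed.

Lemma step_int_clipD Z p q r L : p <= q -> q <= r ->
  step_int Z (step_clip p q L) + step_int Z (step_clip q r L) =
  step_int Z (step_clip p r L).
Proof.
move=> pq qr; rewrite /step_int !big_map -big_split /=; apply: eq_bigr => e _.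
rewrite -mulrDl; congr (_ * _).
(* Additive up to the constant [Z q], which cancels between the two endpoints of each interval. *)
have key x : Z (clip p q x) + Z (clip q r x) = Z (clip p r x) + Z q.
  have [xq|qx] := leP x q.
    have -> : clip q r x = q by rewrite /clip (min_idPr (le_trans xq qr)) (max_idPl xq).
    by rewrite /clip (min_idPr xq) (min_idPr (le_trans xq qr)).
  have -> : clip p q x = q by rewrite /clip (min_idPl (ltW qx)) (max_idPr pq).
  have qm : q <= Num.min r x by rewrite le_min qr ltW.
  by rewrite addrC /clip (max_idPr qm) (max_idPr (le_trans pq qm)).
by rewrite addrACA -opprD !key opprD addrACA subrr addr0.
Qed.

Lemma overlapC e f : overlap e f = overlap f e.
Proof. by rewrite /overlap (minC e.1.2) (maxC e.1.1). Qed.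

Lemma nsq_step_val L r : nsq (step_val L r) =
  \sum_(e <- L) \sum_(f <- L)
     retr (star e.2 * f.2) * \1_(`[Num.max e.1.1 f.1.1, Num.min e.1.2 f.1.2[) r.
Proof.
rewrite /nsq /step_val (star_sum tsP) mulr_suml (retr_sum tsP).
apply: eq_bigr => e _; rewrite mulr_sumr (retr_sum tsP); apply: eq_bigr => f _.
rewrite indicE; have -> : (r \in `[Num.max e.1.1 f.1.1, Num.min e.1.2 f.1.2[%classic) =
    (e.1.1 <= r < e.1.2) && (f.1.1 <= r < f.1.2).
  by rewrite mem_setE in_itv /= ge_max lt_min andbACA.
case: ifP => _ /=; last by rewrite (star0 tsP) mul0r (retr0 tsP) mulr0.
by case: ifP => _; rewrite ?mulr0 ?(retr0 tsP) ?mulr1.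
Qed.

Lemma measurable_nsq_step D L :
  measurable D -> measurable_fun D (fun r => nsq (step_val L r)).
Proof.
move=> mD; under eq_fun do rewrite nsq_step_val.
apply: measurable_sum => e; apply: measurable_sum => f.
by apply: measurable_funM => //; apply: measurable_indic.
Qed.

Lemma integral_nsq_step p q L : steps_in p q L ->
  (\int[mu]_(r in `[p, q[) (nsq (step_val L r))%:E = (step_form L)%:E)%E.
Proof.
move=> h; pose A e f : set R := `[Num.max e.1.1 f.1.1, Num.min e.1.2 f.1.2[%classic.
have mA e f : measurable (A e f) by exact: measurable_itv.
have iA e f : mu.-integrable `[p, q[
    (fun r => ((retr (star e.2 * f.2))%:E * (\1_(A e f) r)%:E)%E).
  apply: integrableZl => //; apply: integrableS (integrable_indic_itv _ _ _ _) => //.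
have nsqE r : ((nsq (step_val L r))%:E = \sum_(e <- L) \sum_(f <- L)
    (retr (star e.2 * f.2))%:E * (\1_(A e f) r)%:E)%E.
  rewrite nsq_step_val -sumEFin; apply: eq_bigr => e _.
  by rewrite -sumEFin; apply: eq_bigr => f _; rewrite EFinM.
under eq_integral do rewrite nsqE.
rewrite integral_sum//; last first.
  by move=> e; apply: integrable_sum => // f _; exact: iA.
rewrite /step_form -sumEFin big_seq [RHS]big_seq; apply: eq_bigr => e eL.
rewrite integral_sum// -sumEFin big_seq [RHS]big_seq; apply: eq_bigr => f fL.
rewrite integralZl//; last first.
  apply: integrableS (integrable_indic_itv _ _ _ _) => //.
rewrite integral_indic; [|by []|exact: mA].
rewrite EFinM muleC; congr (_ * _)%E.
rewrite setIidl; last first.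
  move=> r; rewrite /A /= !in_itv /= ge_max lt_min => /andP[/andP[h1 _] /andP[h2 _]].
  have [h3 _ h4] := h _ eL.
  by rewrite (le_trans h3 h1) (lt_le_trans h2 h4).
rewrite [LHS]lebesgue_measure_itv /= lte_fin /overlap.
case: ltP => ms; first by rewrite -EFinD [Num.max 0 _]max_r// subr_ge0 ltW.
by rewrite [Num.max 0 _]max_l// subr_le0.
Qed.

Lemma step_form_ge0 p q L : steps_in p q L -> 0 <= step_form L.
Proof.
move=> /integral_nsq_step h; rewrite -lee_fin -h; apply: integral_ge0 => r _.
by rewrite lee_fin nsq_ge0.
Qed.

Lemma step_form_le p q L (phi : R -> R) : steps_in p q L ->
  measurable_fun `[p, q[ phi ->
  (forall r, p <= r < q -> nsq (step_val L r) <= phi r) ->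
  ((step_form L)%:E <= \int[mu]_(r in `[p, q[) (phi r)%:E)%E.
Proof.
move=> h mphi hphi; rewrite -(integral_nsq_step h); apply: ge0_le_integral => //.
- by move=> r _; rewrite lee_fin nsq_ge0.
- by apply/measurable_EFinP; exact: measurable_nsq_step.
- exact/measurable_EFinP.
Qed.

(* [\int_p^q dr] applied to [L]: its pairing with [L] itself is computed by
   adding to [L] the constant step of value [- \int L / (q - p)]. *)
Lemma step_int_time_le p q L : p < q -> steps_in p q L ->
  nsq (step_int (fun t => t%:C%:A) L) <= (q - p) * step_form L.
Proof.
move=> pq h; set I := step_int _ L.
have pq0 : 0 < q - p by rewrite subr_gt0.
pose c := (q - p)^-1; pose e0 : R * R * T := ((p, q), - (c%:C *: I)).
have h0 : steps_in p q (e0 :: L).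
  by move=> e; rewrite inE => /orP[/eqP ->/=|/h//]; rewrite lexx ltW.
have ov e : e \in L -> overlap e0 e = e.1.2 - e.1.1.
  move=> /h[h1 h2 h3]; rewrite /overlap /e0 /= (min_idPr h3) (max_idPr h1).
  by rewrite [Num.max 0 _]max_r// subr_ge0.
have ovI : \sum_(e <- L) overlap e0 e * retr (star e0.2 * e.2) = - c * nsq I.
  rewrite /= (starN tsP) (starZr tsP) big_seq.
  have -> : \sum_(e <- L | e \in L) overlap e0 e * retr (- (c%:C *: star I) * e.2) =
     \sum_(e <- L | e \in L) - c * retr (star I * ((e.1.2 - e.1.1)%:C *: e.2)).
    apply: eq_bigr => e eL; rewrite ov// mulNr (retrN tsP) -scalerAl -scalerAr !(retrZ tsP).
    by rewrite mulrN mulNr mulrCA.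
  rewrite -big_seq -mulr_sumr -(retr_sum tsP) -mulr_sumr; congr (_ * retr (_ * _)).
  rewrite /I /step_int; apply: eq_bigr => e _.
  by rewrite -scalerBl -rmorphB -scalerAl mul1r.
have := step_form_ge0 h0; rewrite /step_form big_cons big_cons ovI.
under [X in _ + X]eq_bigr do rewrite big_cons.
rewrite big_split /= -/(step_form L).
have -> : \sum_(e <- L) overlap e e0 * retr (star e.2 * e0.2) = - c * nsq I.
  rewrite -ovI; apply: eq_bigr => e _; rewrite overlapC.
  by rewrite -(retr_star tsP) (starM tsP) (starK tsP).
have -> : overlap e0 e0 = q - p.
  by rewrite /overlap /= minxx maxxx max_r// ltW.
have -> : retr (star (- (c%:C *: I)) * - (c%:C *: I)) = c ^+ 2 * nsq I.
  by rewrite -(nsqZ tsP) -(nsqN tsP).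
rewrite -/(nsq I).
have -> : (q - p) * (c ^+ 2 * nsq I) + - c * nsq I + (- c * nsq I + step_form L)
   = step_form L - c * nsq I by rewrite /c; field; rewrite gt_eqF.
by rewrite subr_ge0 /c mulrC ler_pdivrMr// mulrC.
Qed.

End Steps.

(** * Adapted steps: isometry, martingale property and increments of integrals *)

Section Integrators.
Context {R : realType} {T : algType R[i]} (star : T -> T) (tau : T -> R[i]).
Hypothesis tsP : tracial_star star tau.
Context (F : R -> T -> Prop).
Implicit Types (L : seq (R * R * T)) (Z Y : R -> T).
Local Notation retr := (retr tau).
Local Notation nsq := (nsq star tau).
Local Notation mu := (@lebesgue_measure R).

Record is_star_filtration : Prop := {
  sf1 : forall t, 0 <= t -> F t 1 ;
  sfB : forall t a b, 0 <= t -> F t a -> F t b -> F t (a - b) ;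
  sfZ : forall t k a, 0 <= t -> F t a -> F t (k *: a) ;
  sfM : forall t a b, 0 <= t -> F t a -> F t b -> F t (a * b) ;
  sf_star : forall t a, 0 <= t -> F t a -> F t (star a) ;
  sf_incr : forall s t a, 0 <= s -> s <= t -> F s a -> F t a }.

(* What freeness of increments is used for: the moments of first and second
   order, against elements of the past, and the size of the increments. *)
Record is_free_bm (X : R -> T) : Prop := {
  fbm_adap : forall t, 0 <= t -> F t (X t) ;
  fbm_star : forall t, 0 <= t -> star (X t) = X t ;
  fbm_mean : forall s t a, 0 <= s -> s < t -> F s a -> tau ((X t - X s) * a) = 0 ;
  fbm_cov : forall s t a b, 0 <= s -> s < t -> F s a -> F s b ->
    tau ((X t - X s) * a * (X t - X s) * b) = (t - s)%:C * (tau a * tau b) ;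
  fbm_bound : forall s t, 0 <= s -> s < t ->
    opbound star tau (2 * Num.sqrt (t - s)) (X t - X s) }.

(** Empty intervals are exempt because clipping creates them: an interval to the right of [q]
    becomes [(q, q)] while its value belongs to a later algebra. *)
Definition adapted L :=
  {in L, forall e, e.1.1 < e.1.2 -> F e.1.1 e.2}.

Lemma adapted_cat L L' : adapted L -> adapted L' -> adapted (L ++ L').
Proof. by move=> h h' e; rewrite mem_cat => /orP[/h|/h']. Qed.

Hypothesis sfP : is_star_filtration.

Lemma adapted_neg p q L : 0 <= p -> steps_in p q L -> adapted L -> adapted (step_neg L).
Proof.
move=> p0 hL h e /mapP[f fL ->] /= /(h _ fL) hf.
by rewrite -scaleN1r; apply: (sfZ sfP) => //; have [pf _ _] := hL _ fL; exact: le_trans pf.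
Qed.

Lemma adapted_clip p q p' q' L : 0 <= p' -> p <= q -> steps_in p' q' L ->
  adapted L -> adapted (step_clip p q L).
Proof.
move=> p0 pq hL h e /mapP[f fL ->] /= lt.
have [h1 h2 h3] := hL _ fL.
have fq : f.1.1 < q.
  rewrite ltNge; apply/negP => qf; move: lt.
  by rewrite /clip !min_l ?ltxx// (le_trans qf).
have ff : f.1.1 < f.1.2.
  by rewrite ltNge; apply/negP => hf; move: lt; rewrite ltNge clip_mono.
apply: (sf_incr sfP) (h _ fL ff); first exact: le_trans h1.
by rewrite /clip le_max le_min lexx (ltW fq) orbT.
Qed.

Section Brownian.
Context (X : R -> T).
Hypothesis bmP : is_free_bm X.

Let tau_past s t a b : 0 <= s -> s <= t -> F s a -> F s b ->
  tau (a * (X t - X s) * b) = 0.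
Proof.
move=> s0 st Fa Fb; rewrite -mulrA (tau_comm tsP) -mulrA.
have [->|ns] := eqVneq s t; first by rewrite subrr mul0r (tau0 tsP).
by apply: (fbm_mean bmP) => //; [rewrite lt_neqAle ns|exact: (sfM sfP)].
Qed.

Lemma free_bm_isometry_pair e f : 0 <= e.1.1 -> 0 <= f.1.1 ->
  e.1.1 <= e.1.2 -> f.1.1 <= f.1.2 ->
  (e.1.1 < e.1.2 -> F e.1.1 e.2) -> (f.1.1 < f.1.2 -> F f.1.1 f.2) ->
  retr (star ((X e.1.2 - X e.1.1) * e.2) * ((X f.1.2 - X f.1.1) * f.2)) =
  overlap e f * retr (star e.2 * f.2).
Proof.
wlog: e f / e.1.1 <= f.1.1.
  move=> H e0 f0 he hf Fe Ff.
  have [ef|fe] := leP e.1.1 f.1.1; first exact: H.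
  rewrite -(retr_star tsP) (starM tsP) (starK tsP) (H f e (ltW fe))//.
  by rewrite overlapC -[in RHS](retr_star tsP) [in RHS](starM tsP) (starK tsP).
case: e f => [[s u] a] [[s' u'] b] /= ss' s0 s'0 su su' Fa Fb.
rewrite /overlap /= (max_r ss').
have [es|nes] := eqVneq s u.
  rewrite es subrr mul0r (star0 tsP) mul0r (retr0 tsP) max_l ?mul0r//.
  by rewrite subr_le0 ge_min -es ss'.
have [es'|nes'] := eqVneq s' u'.
  rewrite es' subrr mul0r mulr0 (retr0 tsP) max_l ?mul0r//.
  by rewrite subr_le0 ge_min lexx orbT.
have {}Fa : F s' a by apply: (sf_incr sfP) (Fa _) => //; rewrite lt_neqAle nes.
have {}Fb : F s' b by apply: Fb; rewrite lt_neqAle nes'.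
have Fc : F s' (star a) by apply: (sf_star sfP).
have u0 : 0 <= u by exact: le_trans su.
have u'0 : 0 <= u' by exact: le_trans su'.
have FX r v : 0 <= r -> r <= v -> F v (X r).
  by move=> r0 rv; apply: (sf_incr sfP) (fbm_adap bmP r0).
have sX r : 0 <= r -> star (X r) = X r := fbm_star bmP (t := r).
rewrite (starM tsP) (starB tsP) !sX//.
have FD r v w : 0 <= r -> 0 <= v -> s' <= w -> r <= w -> v <= w -> F w (X r - X v).
  move=> r0 v0 sw rw vw; apply: (sfB sfP); [exact: le_trans rw|exact: FX|exact: FX].
have Fs w c : s' <= w -> F s' c -> F w c by move=> sw; exact: (sf_incr sfP).
have cov v : s' <= v ->
    tau (star a * (X v - X s') * ((X v - X s') * b)) = (v - s')%:C * tau (star a * b).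
  move=> sv; rewrite -mulrA (tau_comm tsP) -!mulrA.
  rewrite (mulrA (X v - X s')) -{1}[X v - X s']mulr1.
  have [<-|nsv] := eqVneq s' v; first by rewrite !subrr !mul0r (tau0 tsP).
  have lt : s' < v by rewrite lt_neqAle nsv.
  rewrite (fbm_cov bmP)//; [|exact: (sf1 sfP)|exact: (sfM sfP)].
  by rewrite (tau1 tsP) mul1r (tau_comm tsP b).
suff : tau (star a * (X u - X s) * ((X u' - X s') * b)) =
    (Num.max 0 (Num.min u u' - s'))%:C * tau (star a * b).
  move=> e; rewrite /retr e.
  by case: (tau (star a * b)) => x y /=; rewrite mul0r subr0.
have [us'|s'u] := leP u s'.
  rewrite mulrA tau_past//; last by apply: (sfM sfP) => //; exact: FD.
  by rewrite max_l ?mul0r// subr_le0 ge_min us'.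
(* The increment before [s'] belongs to the past of [s'] and is annihilated by the increment of [f];
   only the one after [s'] contributes. *)
have -> : X u - X s = (X u - X s') + (X s' - X s) by rewrite addrA subrK.
rewrite mulrDr mulrDl (tauD tsP) (mulrA (star a * (X s' - X s))).
rewrite (tau_past (s := s') (t := u') (a := _ * (X s' - X s)))//; last first.
  by apply: (sfM sfP) => //; exact: FD.
(* The longer of the two increments is cut at the end of the shorter one. The excess is an increment
   after all the other factors, so its term has trace 0, and [cov] evaluates the common part. *)
rewrite addr0; have [uu'|u'u] := leP u u'.
  have -> : X u' - X s' = (X u' - X u) + (X u - X s') by rewrite addrA subrK.
  rewrite mulrDl mulrDr (tauD tsP) mulrA tau_past//; last 2 first.
  - apply: (sfM sfP) => //; [apply: Fs => //; exact: ltW|apply: FD => //; exact: ltW].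
  - by apply: Fs => //; exact: ltW.
  by rewrite add0r cov ?(ltW s'u)// max_r// subr_ge0 ltW.
have -> : X u - X s' = (X u - X u') + (X u' - X s') by rewrite addrA subrK.
rewrite mulrDr mulrDl (tauD tsP) tau_past ?(ltW u'u)//; last 2 first.
- exact: Fs.
- by apply: (sfM sfP) => //; [exact: FD|exact: Fs].
by rewrite add0r cov// max_r// subr_ge0.
Qed.

Lemma free_bm_isometry p q L : 0 <= p -> steps_in p q L -> adapted L ->
  nsq (step_int X L) = step_form star tau L.
Proof.
move=> p0 h aL; rewrite /nsq /step_int (star_sum tsP) mulr_suml (retr_sum tsP).
rewrite /step_form big_seq [RHS]big_seq; apply: eq_bigr => e eL.
rewrite mulr_sumr (retr_sum tsP) big_seq [RHS]big_seq; apply: eq_bigr => f fL.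
have [h1 h2 h3] := h _ eL; have [g1 g2 g3] := h _ fL.
apply: free_bm_isometry_pair => //; [exact: le_trans h1|exact: le_trans g1| |].
  exact: aL.
exact: aL.
Qed.

Lemma free_bm_martingale p q L b : 0 <= p -> steps_in p q L -> adapted L ->
  F p b -> retr (step_int X L * b) = 0.
Proof.
move=> p0 h aL Fb; rewrite /step_int mulr_suml (retr_sum tsP) big_seq big1// => e eL.
have [h1 h2 h3] := h _ eL; rewrite /retr -mulrA.
have e0 := le_trans p0 h1.
have [->|ne] := eqVneq e.1.1 e.1.2; first by rewrite subrr mul0r (tau0 tsP).
have lt : e.1.1 < e.1.2 by rewrite lt_neqAle ne.
rewrite (fbm_mean bmP)//; apply: (sfM sfP) => //; first exact: aL.
exact: (sf_incr sfP) Fb.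
Qed.

End Brownian.

(* Abstract form of [is_L2_integral]: approximation by steps, up to [e]. *)
Definition L2_integral Z Y (t : R) (I : T) := forall e : R, 0 < e -> exists L,
  [/\ steps_in 0 t L, adapted L,
   measurable_fun `[0, t[ (fun r => nsq (step_val L r - Y r)),
   (\int[mu]_(r in `[0%R, t[) (nsq (step_val L r - Y r))%:E <= e%:E)%E &
   nsq (step_int Z L - I) <= e].

(* [kappa = 1] for the free Brownian motion and [kappa = id] for the time. *)
Lemma L2_integral_increment Z Y (kappa : R -> R) t u I I' (C : R) :
  (forall r, 0 <= r -> 0 <= kappa r) ->
  (forall p q L, 0 <= p -> p <= q -> steps_in p q L -> adapted L ->
     nsq (step_int Z L) <= kappa (q - p) * step_form star tau L) ->
  L2_integral Z Y t I -> L2_integral Z Y u I' -> 0 <= t -> t < u -> 0 <= C ->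
  F t (Y t) -> (forall r, t <= r < u -> nsq (Y r - Y t) <= C) ->
  forall e : R, 0 < e -> exists L, [/\ steps_in t u L, adapted L,
    nsq (I' - I - (Z u - Z t) * Y t - step_int Z L) <= e &
    nsq (step_int Z L) <= kappa (u - t) * (2 * C * (u - t)) + e].
Proof.
move=> k0 kP IP I'P t0 tu C0 FY YC e e0.
have ut0 : 0 <= u - t by rewrite subr_ge0 ltW.
have u0 : 0 <= u by rewrite (le_trans t0)// ltW.
have kt := k0 _ t0; have kut := k0 _ ut0.
(* With both integrals approximated up to [e / N], the first error is at most [8 * (1 + kappa t)]
   times that and the second exceeds its main term by at most [2 * kappa (u - t)] times that. *)
pose N := 8 * (1 + kappa t) + 2 * kappa (u - t).
have N0 : 0 < N by rewrite /N; lra.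
pose d := e / N; have d0 : 0 < d by exact: divr_gt0.
have [L1 [s1 a1 m1 i1 n1]] := IP d d0; have [L2 [s2 a2 m2 i2 n2]] := I'P d d0.
pose L := step_clip t u L2 ++ [:: ((t, u), - Y t)].
have sL : steps_in t u L.
  apply: steps_in_cat; first exact: steps_in_clip (ltW tu) s2.
  by move=> f; rewrite inE => /eqP -> /=; rewrite !lexx ltW.
have aL : adapted L.
  apply: adapted_cat; first by apply: adapted_clip s2 _ => //; exact: ltW.
  by move=> f; rewrite inE => /eqP -> /= _; rewrite -scaleN1r; exact: (sfZ sfP).
(* The two approximations of [Y] on [[0, t]] come from different integrals; their difference has a
   small integral, so both may be removed there. *)
pose M := step_clip 0 t L2 ++ step_neg L1.
have sM : steps_in 0 t M.
  apply: steps_in_cat; first exact: steps_in_clip t0 s2.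
  exact: steps_in_neg.
have aM : adapted M.
  by apply: adapted_cat; [exact: adapted_clip s2 _|exact: adapted_neg s1 _].
have dN : d * N = e by rewrite /d divfK// gt_eqF.
have dist2 D (f g : R -> R) a b : measurable D ->
    (forall r, 0 <= f r) -> (forall r, 0 <= g r) ->
    measurable_fun D f -> measurable_fun D g ->
    (\int[mu]_(r in D) (f r)%:E <= a%:E)%E -> (\int[mu]_(r in D) (g r)%:E <= b%:E)%E ->
    (\int[mu]_(r in D) (2 * f r + 2 * g r)%:E <= (2 * a + 2 * b)%:E)%E.
  move=> mD f0 g0 mf mg fa gb; under eq_integral do rewrite EFinD !EFinM.
  have mE2 (k : R -> R) : measurable_fun D k -> measurable_fun D (fun r => (2%:E * (k r)%:E)%E).
    by move=> mk; apply: measurable_funeM; exact/measurable_EFinP.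
  rewrite ge0_integralD//; first last.
  - exact: mE2.
  - by move=> r _; rewrite mule_ge0// lee_fin.
  - exact: mE2.
  - by move=> r _; rewrite mule_ge0// lee_fin.
  rewrite !ge0_integralZl//; try by move=> *; rewrite lee_fin.
  - by rewrite [leRHS]EFinD (EFinM 2 a) (EFinM 2 b); apply: leeD; rewrite lee_pmul2l//.
  - exact/measurable_EFinP.
  - exact/measurable_EFinP.
have sub2 p q : 0 <= p -> q <= u ->
    measurable_fun `[p, q[ (fun r => nsq (step_val L2 r - Y r)) /\
    (\int[mu]_(r in `[p, q[) (nsq (step_val L2 r - Y r))%:E <= d%:E)%E.
  move=> p0 qu; have pq : (`[p, q[ : set R) `<=` `[0, u[.
    move=> r; rewrite /= !in_itv /= => /andP[h1 h2].
    by rewrite (le_trans p0 h1) (lt_le_trans h2 qu).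
  split; first by apply: measurable_funS m2.
  apply: le_trans i2; apply: ge0_subset_integral => //; first exact/measurable_EFinP.
  by move=> r _; rewrite lee_fin nsq_ge0.
have formM : step_form star tau M <= 2 * d + 2 * d.
  have [m2t i2t] := sub2 0 t (lexx _) (ltW tu).
  rewrite -lee_fin; apply: le_trans (dist2 _ _ _ _ _ _ _ _ m2t m1 i2t i1) => //;
    try by move=> r; exact: nsq_ge0.
  apply: step_form_le sM _ _ => //.
    by apply: measurable_funD; apply: measurable_funM.
  move=> r rt; rewrite step_val_cat step_val_neg step_val_clip//.
  rewrite -(subrKA (Y r)) -[Y r - _]opprB -[X in _ <= _ + 2 * X](nsqN tsP).
  exact: nsqD_le.
have formL : step_form star tau L <= 2 * d + 2 * (C * (u - t)).
  have [m2t i2t] := sub2 t u t0 (lexx _).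
  have iC : (\int[mu]_(r in `[t, u[) C%:E <= (C * (u - t))%:E)%E.
    by rewrite integral_cst//= lebesgue_measure_itv /= lte_fin tu -EFinB -EFinM.
  rewrite -lee_fin; apply: le_trans (dist2 _ _ _ _ _ _ _ _ m2t _ i2t iC) => //;
    try by move=> r; exact: nsq_ge0.
  apply: step_form_le sL _ _ => //.
    by apply: measurable_funD => //; apply: measurable_funM.
  move=> r rt; rewrite step_val_cat step_val_clip//.
  rewrite {2}/step_val big_seq1 /= rt -(subrKA (Y r)).
  by apply: le_trans (nsqD_le tsP _ _) _; rewrite lerD2l ler_pM2l// YC.
exists L; split => //.
  have -> : I' - I - (Z u - Z t) * Y t - step_int Z L =
     (I' - step_int Z L2) + (step_int Z L1 - I) + step_int Z M.
    rewrite !step_int_cat step_int_neg -(step_int_clip Z s2).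
    rewrite -(step_int_clipD Z L2 t0 (ltW tu)) {2}/step_int big_seq1 /= mulrN.
    move: (step_int _ _) (step_int _ _) (step_int _ _) (_ * Y t) => x y z c.
    rewrite opprB subrKA [RHS]addrAC.
    by rewrite -[RHS]addrA subrKA opprD (addrC (- y)) (addrA I' (- z)) subrKA addrAC.
  have nM : nsq (step_int Z M) <= kappa t * (4 * d).
    have := kP 0 t M (lexx _) t0 sM aM; rewrite subr0 => /le_trans; apply.
    by apply: ler_wpM2l => //; apply: le_trans formM _; lra.
  have n2' : nsq (I' - step_int Z L2) <= d by rewrite -(nsqN tsP) opprB.
  have := nsqD_le tsP (I' - step_int Z L2 + (step_int Z L1 - I)) (step_int Z M).
  have := nsqD_le tsP (I' - step_int Z L2) (step_int Z L1 - I).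
  have : 0 <= kappa (u - t) * d by rewrite mulr_ge0// ltW.
  by rewrite -dN /N; nra.
apply: le_trans (kP t u L t0 (ltW tu) sL aL) _.
apply: le_trans (ler_wpM2l kut formL) _.
have : 0 <= kappa t * d by rewrite mulr_ge0// ltW.
by rewrite -dN /N; nra.
Qed.

End Integrators.

Lemma increment_rearrange (V : zmodType) (a x x' y y' p q : V) :
  a + x - y - (a + x' - y') = p - q + ((x - x' - p) - (y - y' - q)).
Proof.
rewrite [RHS]addrC (opprD _ (- q)) (addrACA (x - x')) -(opprD p) subrK.
by rewrite -(addrA a x) -(addrA a x') (addrC a (x - y)) addrKA !opprD addrACA.
Qed.

(** * Increments of the moments *)

Section JacobiMoments.
Context {R : realType} {T : algType R[i]} (star : T -> T) (tau : T -> R[i]).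
Hypothesis tsP : tracial_star star tau.
Context (F : R -> T -> Prop) (X Y I D : R -> T) (P Q : T) (theta : R).
Hypothesis sfP : is_star_filtration star F.
Hypothesis bmP : is_free_bm star tau F X.
Local Notation retr := (retr tau).
Local Notation nsq := (nsq star tau).
Local Notation nrm := (nrm star tau).
Local Notation time := (fun t : R => t%:C%:A : T).

Hypothesis FY : forall t, 0 <= t -> F t (Y t).
Hypothesis YY : forall t, 0 <= t -> star (Y t) * Y t = 1 /\ Y t * star (Y t) = 1.
Hypothesis YI : forall t, 0 <= t -> L2_integral star tau F X Y t (I t).
Hypothesis YD : forall t, 0 <= t -> L2_integral star tau F time Y t (D t).
Hypothesis YE : forall t, 0 <= t -> Y t = Y 0 + 'i%C *: I t - (2^-1)%:C *: D t.
Hypothesis FP : F 0 P.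
Hypothesis FQ : F 0 Q.
Hypothesis starP : star P = P.
Hypothesis starQ : star Q = Q.
Hypothesis PP : P * P = P.
Hypothesis QQ : Q * Q = Q.
Hypothesis tauQ : tau Q = theta%:C.

Let dist_le0 (x y : R) : (forall e, 0 < e -> x <= y + e) -> x <= y.
Proof. by move=> h; apply/ler_addgt0Pr => e /h. Qed.

Let rI t u := I u - I t - (X u - X t) * Y t.
Let rD t u := D u - D t - (time u - time t) * Y t.

Let limit_nsq a (C : R) :
  (forall e, 0 < e -> exists2 b, nsq (a - b) <= e & nsq b <= C + e) ->
  nsq a <= 2 * C.
Proof.
move=> h; apply: dist_le0 => e e0; have e4 : 0 < e / 4 by rewrite divr_gt0.
have [b h1 h2] := h _ e4; rewrite -(subrK b a).
by apply: le_trans (nsqD_le tsP _ _) _; lra.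
Qed.

Let increment Z J (kappa : R -> R) (C : R) t u :
  (forall r, 0 <= r -> 0 <= kappa r) ->
  (forall p q L, 0 <= p -> p <= q -> steps_in p q L -> adapted F L ->
     nsq (step_int Z L) <= kappa (q - p) * step_form star tau L) ->
  (forall t, 0 <= t -> L2_integral star tau F Z Y t (J t)) ->
  0 <= t -> t < u -> 0 <= C ->
  (forall r, t <= r < u -> nsq (Y r - Y t) <= C) ->
  nsq (J u - J t - (Z u - Z t) * Y t) <= 4 * kappa (u - t) * C * (u - t).
Proof.
move=> k0 kP JP t0 tu C0 hC; have u0 : 0 <= u by rewrite (le_trans t0)// ltW.
apply: (@le_trans _ _ (2 * (kappa (u - t) * (2 * C * (u - t))))); last by lra.
apply: limit_nsq => e e0.
have [L [_ _ h1 h2]] := L2_integral_increment tsP sfP k0 kP (JP _ t0) (JP _ u0)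
  t0 tu C0 (FY t0) hC e0.
by exists (step_int Z L).
Qed.

Let X_le p q L : 0 <= p -> p <= q -> steps_in p q L -> adapted F L ->
  nsq (step_int X L) <= 1 * step_form star tau L.
Proof.
by move=> p0 pq sL aL; rewrite mul1r (free_bm_isometry tsP sfP bmP p0 sL aL).
Qed.

Let time_le p q L : 0 <= p -> p <= q -> steps_in p q L -> adapted F L ->
  nsq (step_int time L) <= (q - p) * step_form star tau L.
Proof.
move=> p0; rewrite le_eqVlt => /predU1P[<-|pq] sL aL; last exact: step_int_time_le.
rewrite subrr mul0r /step_int big_seq big1 ?(nsq0 tsP)// => e /sL[h1 h2 h3].
have -> : e.1.1 = e.1.2 by apply/le_anti; rewrite h2 (le_trans h3).
by rewrite subrr mul0r.
Qed.

Let rI_le (C : R) t u : 0 <= t -> t < u -> 0 <= C ->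
  (forall r, t <= r < u -> nsq (Y r - Y t) <= C) -> nsq (rI t u) <= 4 * C * (u - t).
Proof.
move=> t0 tu C0 hC.
have := increment (kappa := fun=> 1) (fun _ _ => ler01) X_le YI t0 tu C0 hC.
by rewrite mulr1.
Qed.

Let rD_le (C : R) t u : 0 <= t -> t < u -> 0 <= C ->
  (forall r, t <= r < u -> nsq (Y r - Y t) <= C) ->
  nsq (rD t u) <= 4 * (u - t) * C * (u - t).
Proof.
by move=> t0 tu C0 hC; apply: (increment (kappa := id) _ time_le YD).
Qed.

Let nrmY t : 0 <= t -> nrm (Y t) <= 1.
Proof. by move=> /YY[h1 h2]; apply: nrm_opbound => //; exact: opbound_unitary. Qed.

Let nsqY4 t u : 0 <= t -> 0 <= u -> nsq (Y u - Y t) <= 4.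
Proof.
move=> t0 u0; rewrite (_ : 4 = 2 ^+ 2); last by ring.
rewrite -(nrm_le tsP)//; apply: le_trans (nrmD tsP _ _) _.
by rewrite (nrmN tsP) (_ : 2 = 1 + 1) // lerD// nrmY.
Qed.

(** The remainder is an L2 limit of integrals of adapted steps supported in [[t, u]], each of them
    orthogonal to the past of [t]. *)
Let rI_past t u b : 0 <= t -> t < u -> F t b -> retr (rI t u * b) = 0.
Proof.
move=> t0 tu Fb; have u0 : 0 <= u by rewrite (le_trans t0)// ltW.
have hC r : t <= r < u -> nsq (Y r - Y t) <= 4.
  by move=> /andP[tr _]; apply: nsqY4 => //; exact: le_trans tr.
have k0 : forall r : R, 0 <= r -> 0 <= (fun=> 1 : R) r by [].
apply/eqP; rewrite -normr_le0; apply: dist_le0 => e e0; rewrite add0r.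
pose d := (e / (1 + nrm b)) ^+ 2.
have b0 := nrm_ge0 star tau b; have b1 : 0 < 1 + nrm b by lra.
have d0 : 0 < d by rewrite exprn_gt0// divr_gt0.
have [L [sL aL h1 _]] := L2_integral_increment tsP sfP k0 X_le (YI t0) (YI u0)
  t0 tu (ler0n R 4) (FY t0) hC d0.
have := free_bm_martingale tsP sfP bmP t0 sL aL Fb.
rewrite -[rI t u](subrK (step_int X L)) mulrDl (retrD tsP) => ->; rewrite addr0.
apply: le_trans (retr_CS tsP _ _) _.
have : nrm (rI t u - step_int X L) <= e / (1 + nrm b).
  by rewrite (nrm_le tsP)// divr_ge0// ltW.
rewrite ler_pdivlMr// mulrDr mulr1; have := nrm_ge0 star tau (rI t u - step_int X L).
lra.
Qed.

Let dYE t u : 0 <= t -> t < u ->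
  Y u - Y t = 'i%C *: (X u - X t) * Y t - ((u - t) / 2)%:C *: Y t
     + ('i%C *: rI t u - (2^-1)%:C *: rD t u).
Proof.
move=> t0 tu; rewrite /rI /rD.
rewrite !(scalerBr _ (_ - _)) -(scalerAl 'i%C).
have -> : (2^-1)%:C *: ((time u - time t) * Y t) = ((u - t) / 2)%:C *: Y t.
  by rewrite -scalerBl -rmorphB -scalerAl mul1r scalerA -rmorphM mulrC.
set p := 'i%C *: (_ * Y t); set q := _ *: Y t; rewrite !scalerBr.
rewrite (YE (ltW (le_lt_trans t0 tu))) (YE t0); exact: increment_rearrange.
Qed.

Let nrm_sq_le a (r : R) : 0 <= r -> nsq a <= r ^+ 2 -> nrm a <= r.
Proof. by move=> r0; rewrite -(nrm_le tsP). Qed.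

Let nrm_comb a b : nrm ('i%C *: a - (2^-1)%:C *: b) <= nrm a + nrm b / 2.
Proof.
apply: le_trans (nrmD tsP _ _) _; rewrite (nrmN tsP) (nrmi tsP) (nrmZ tsP).
by rewrite lerD2l mulrC ger0_norm// invr_ge0.
Qed.

Let nrm_XY t u : 0 <= t -> t < u ->
  nrm ((X u - X t) * Y t) <= 2 * Num.sqrt (u - t).
Proof.
move=> t0 tu; have [k0 /(_ (Y t))[h _]] := fbm_bound bmP t0 tu.
by apply: le_trans h _; apply: ler_piMr => //; exact: nrmY.
Qed.

(** First pass, with the bound 4 given by unitarity. In units of [sqrt (u - t)] the terms are at
    most 2 for the Brownian increment, 1/2 for the drift, 4 for [rI] and 2 for half of [rD]; 9 is
    their sum rounded up. *)
Let Y_holder t u : 0 <= t -> t < u -> u - t <= 1 -> nsq (Y u - Y t) <= 81 * (u - t).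
Proof.
move=> t0 tu tu1; have u0 := ltW (le_lt_trans t0 tu).
have hC r : t <= r < u -> nsq (Y r - Y t) <= 4.
  by move=> /andP[tr _]; apply: nsqY4 => //; exact: le_trans tr.
set s := Num.sqrt (u - t); have s0 : 0 <= s := sqrtr_ge0 _.
have ss : s ^+ 2 = u - t by rewrite sqr_sqrtr// subr_ge0 ltW.
have s1 : s <= 1 by rewrite -sqrtr1 ler_wsqrtr.
have hI : nrm (rI t u) <= 4 * s.
  apply: nrm_sq_le; first by rewrite mulr_ge0.
  by apply: le_trans (rI_le t0 tu (ler0n R 4) hC) _; rewrite -ss; lra.
have hD : nrm (rD t u) <= 4 * s.
  apply: nrm_sq_le; first by rewrite mulr_ge0.
  by apply: le_trans (rD_le t0 tu (ler0n R 4) hC) _; rewrite -ss; nra.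
have hX := nrm_XY t0 tu; rewrite -/s in hX.
rewrite (_ : 81 * (u - t) = (9 * s) ^+ 2); last by rewrite exprMn ss; congr (_ * _); ring.
rewrite -(nrm_le tsP) ?mulr_ge0// dYE//.
apply: le_trans (nrmD tsP _ _) _.
apply: (@le_trans _ _ ((2 * s + s / 2) + (4 * s + 4 * s / 2))); last by lra.
apply: lerD; last by apply: le_trans (nrm_comb _ _) _; lra.
apply: le_trans (nrmD tsP _ _) _; apply: lerD.
  by rewrite -scalerAl (nrmi tsP).
rewrite (nrmN tsP) (nrmZ tsP) ger0_norm; last by rewrite divr_ge0// subr_ge0 ltW.
have sY : s * nrm (Y t) <= 1 by rewrite mulr_ile1 ?nrmY ?nrm_ge0.
have := ler_wpM2l s0 sY; rewrite mulr1 mulrA -expr2 ss; lra.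
Qed.

(** Second pass: this replaces the bound 4 in [rI_le] and [rD_le] and gains a factor [sqrt (u - t)]
    in L2 norm. The constant 18 below is the root of [4 * 81]. *)
Let hC2 t u : 0 <= t -> t < u -> u - t <= 1 ->
  forall r, t <= r < u -> nsq (Y r - Y t) <= 81 * (u - t).
Proof.
move=> t0 tu tu1 r /andP[]; rewrite le_eqVlt => /predU1P[<-|tr] ru.
  by rewrite subrr (nsq0 tsP) mulr_ge0// subr_ge0 ltW.
by apply: le_trans (Y_holder t0 tr _) _; lra.
Qed.

(** Pairs of a time and a lag. Taken as the index set of the orders of magnitude, they make all
    constants uniform in the time. *)
Definition instant := {p : R * R | [&& 0 <= p.1, 0 < p.2 & p.2 <= 1]}.
Implicit Types i : instant.

Let tm i : R := (sval i).1.
Let dl i : R := (sval i).2.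
Let sq i : R := Num.sqrt (dl i).
Let W i := 'i%C *: (X (tm i + dl i) - X (tm i)).
Let Y0 i := Y (tm i).
Let Y1 i := Y (tm i + dl i).
Let E i := 'i%C *: rI (tm i) (tm i + dl i) - (2^-1)%:C *: rD (tm i) (tm i + dl i).

Let instP i : [/\ 0 <= tm i, tm i < tm i + dl i, 0 < dl i, dl i <= 1 & 0 <= tm i + dl i].
Proof.
case: i => [[t h]] /= p; rewrite /tm /dl /=; case/and3P: p => t0 h0 h1.
by split => //; [rewrite ltrDl|rewrite addr_ge0// ltW].
Qed.

Let lagE i : tm i + dl i - tm i = dl i. Proof. by rewrite addrC addKr. Qed.

Let sq01 i : 0 <= sq i <= 1.
Proof. by have [_ _ _ h1 _] := instP i; rewrite sqrtr_ge0 -sqrtr1 ler_wsqrtr. Qed.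

Let sq2 i : sq i ^+ 2 = dl i.
Proof. by have [_ _ h0 _ _] := instP i; rewrite sqr_sqrtr// ltW. Qed.

Let OB_W : OB star tau sq 1 W.
Proof.
exists 2 => // i; apply: (opboundi tsP); have [t0 th _ _ _] := instP i.
by rewrite expr1 /sq -{1}lagE; exact: (fbm_bound bmP).
Qed.

Let rI_small i : nrm (rI (tm i) (tm i + dl i)) <= 18 * sq i ^+ 2.
Proof.
have [t0 th h0 h1 _] := instP i; apply: nrm_sq_le.
  by rewrite mulr_ge0 ?exprn_ge0 ?sqrtr_ge0.
have hl : tm i + dl i - tm i <= 1 by rewrite lagE.
apply: le_trans (rI_le t0 th _ (hC2 t0 th hl)) _; rewrite lagE.
  by rewrite mulr_ge0// ltW.
by rewrite sq2; lra.
Qed.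

Let rD_small i : nrm (rD (tm i) (tm i + dl i)) <= 18 * sq i ^+ 3.
Proof.
have [t0 th h0 h1 _] := instP i; apply: nrm_sq_le.
  by rewrite mulr_ge0 ?exprn_ge0 ?sqrtr_ge0.
have hl : tm i + dl i - tm i <= 1 by rewrite lagE.
apply: le_trans (rD_le t0 th _ (hC2 t0 th hl)) _; rewrite lagE.
  by rewrite mulr_ge0// ltW.
rewrite (_ : (18 * sq i ^+ 3) ^+ 2 = 18 ^+ 2 * (sq i ^+ 2) ^+ 3); last by ring.
by rewrite sq2; lra.
Qed.

Let OL_E : OL star tau sq 2 E.
Proof.
(* 18 from [rI] plus one half of 18 from [rD]. *)
exists 27 => // i; apply: le_trans (nrm_comb _ _) _.
have hI := rI_small i; have hD := rD_small i.
have : sq i ^+ 3 <= sq i ^+ 2 by have /andP[? ?] := sq01 i; rewrite exprSr ler_piMr ?sqr_ge0.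
lra.
Qed.

Let OR_E b : (forall i, F (tm i) (b i)) -> OB star tau sq 0 b ->
  OR sq 3 (fun i => retr (E i * b i)).
Proof.
move=> Fb [K K0 hK]; exists (9 * K); first by rewrite mulr_ge0.
move=> i; have [t0 th h0 h1 _] := instP i.
have e : retr ('i%C *: rI (tm i) (tm i + dl i) * b i) = 0.
  by rewrite -scalerAl scalerAr rI_past//; exact: (sfZ sfP).
rewrite /E mulrBl (retrB tsP) e sub0r normrN -scalerAl (retrZ tsP) normrM.
have hb : nrm (b i) <= K by have := nrm_opbound tsP (hK i); rewrite expr0 mulr1.
have := retr_CS tsP (rD (tm i) (tm i + dl i)) (b i).
have := rD_small i; have := nrm_ge0 star tau (b i).
have := nrm_ge0 star tau (rD (tm i) (tm i + dl i)).
rewrite ger0_norm ?invr_ge0//.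
set x := nrm _; set y := nrm _; set z := `|_| => x0 y0 xs zx.
have : x * y <= 18 * sq i ^+ 3 * K by apply: ler_pM.
lra.
Qed.

Let mom (n : nat) (t : R) := retr ((P * (Y t * Q * star (Y t))) ^+ n * P).

Let Fi i a b := @sfM _ _ _ _ sfP (tm i) a b (let: And5 h _ _ _ _ := instP i in h).
Let Fstar i a := @sf_star _ _ _ _ sfP (tm i) a (let: And5 h _ _ _ _ := instP i in h).
Let FYi i : F (tm i) (Y0 i). Proof. by have [t0 _ _ _ _] := instP i; exact: FY. Qed.
Let FPi i : F (tm i) P.
Proof. by have [t0 _ _ _ _] := instP i; exact: (sf_incr sfP) FP. Qed.
Let FQi i : F (tm i) Q.
Proof. by have [t0 _ _ _ _] := instP i; exact: (sf_incr sfP) FQ. Qed.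
Let YY0 i : star (Y0 i) * Y0 i = 1 /\ Y0 i * star (Y0 i) = 1.
Proof. by have [t0 _ _ _ _] := instP i; exact: YY. Qed.
Let YY1 i : star (Y1 i) * Y1 i = 1 /\ Y1 i * star (Y1 i) = 1.
Proof. by have [_ _ _ _ t0] := instP i; exact: YY. Qed.

Let Y1E i : Y1 i = Y0 i + W i * Y0 i - (sq i ^+ 2 / 2)%:C *: Y0 i + E i.
Proof.
have [t0 th _ _ _] := instP i; rewrite -[Y1 i](subrK (Y0 i)) /Y1 /Y0 dYE//.
by rewrite addrC !addrA lagE sq2.
Qed.

Let starW i : star (W i) = - W i.
Proof.
have [t0 _ _ _ u0] := instP i; rewrite /W (starZ tsP) (starB tsP).
rewrite !(fbm_star bmP)// -scaleNr; congr (_ *: _).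
by apply/eqP; rewrite eq_complex /= oppr0 !eqxx.
Qed.

Let tauW i a : F (tm i) a -> tau (W i * a) = 0.
Proof.
move=> Fa; have [t0 th _ _ _] := instP i.
by rewrite /W -scalerAl (tauZ tsP) (fbm_mean bmP)// mulr0.
Qed.

Let tauWW i a b : F (tm i) a -> F (tm i) b ->
  tau (W i * a * W i * b) = - (sq i ^+ 2)%:C * (tau a * tau b).
Proof.
move=> Fa Fb; have [t0 th _ _ _] := instP i.
rewrite /W -!scalerAl -scalerAr -!scalerAl !(tauZ tsP) (fbm_cov bmP)// lagE sq2.
rewrite !mulrA -expr2 sqr_i mulN1r; by rewrite mulNr.
Qed.

Lemma jacobi_moment_holder n : exists2 K : R, 0 <= K & forall t h : R,
  0 <= t -> 0 < h -> h <= 1 -> `|mom n (t + h) - mom n t| <= K * Num.sqrt h.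
Proof.
have [K K0 hK] := moment_holder tsP sq01 YY0 YY1 starP starQ
  PP QQ Y1E OB_W starW OL_E n.
exists K => // t h t0 h0 h1.
have p : [&& 0 <= (t, h).1, 0 < (t, h).2 & (t, h).2 <= 1] by rewrite /= t0 h0 h1.
by have := hK (exist _ (t, h) p); rewrite expr1.
Qed.

Lemma jacobi_moment_increment n : exists2 K : R, 0 <= K & forall t h : R,
  0 <= t -> 0 < h -> h <= 1 ->
  `|mom n.+1 (t + h) - mom n.+1 t
    - h * (n.+1%:R * (theta * mom n t - mom n.+1 t) + n.+1%:R *
        \sum_(k < n) mom (n - k)%N t * (mom k t - mom k.+1 t))|
  <= K * (h * Num.sqrt h).
Proof.
have [K K0 hK] := moment_increment tsP sq01 Fi Fstar FYi FPi FQi YY0 YY1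
  starP starQ PP QQ tauQ Y1E OB_W starW OL_E OR_E tauW tauWW n.
exists K => // t h t0 h0 h1.
have p : [&& 0 <= (t, h).1, 0 < (t, h).2 & (t, h).2 <= 1] by rewrite /= t0 h0 h1.
by have := hK (exist _ (t, h) p); rewrite (exprSr (sq _) 2) sq2.
Qed.

End JacobiMoments.

(** * Moments of the semicircle law *)

Section Semicircle.
Context {R : realType}.
Implicit Types (f F : R -> R) (a b v x : R).
Local Notation mu := (@lebesgue_measure R).

Lemma integrable_continuous f a b :
  continuous f -> mu.-integrable `[a, b] (EFin \o f).
Proof.
move=> cf; apply: continuous_compact_integrable; first exact: segment_compact.
exact: continuous_subspaceT.
Qed.

Lemma Rintegral_derive F f a b : a < b -> continuous F -> continuous f ->
  (forall x, a < x < b -> is_derive x 1 F (f x)) ->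
  \int[mu]_(x in `[a, b]) f x = F b - F a.
Proof.
move=> ab cF cf dF; rewrite /Rintegral (continuous_FTC2 (F := F) ab).
- by rewrite -EFinB.
- exact: continuous_subspaceT.
- split.
  + by move=> x; rewrite in_itv /= => /dF[].
  + by apply: cvg_at_right_filter; exact: cF.
  + by apply: cvg_at_left_filter; exact: cF.
- by move=> x; rewrite in_itv /= => /dF dx; rewrite derive1E derive_val.
Qed.

Definition semicircle_density v x := Num.sqrt (4 * v - x ^+ 2) / (2 * pi * v).

Definition semicircle_moment v (n : nat) :=
  \int[mu]_(x in `[- (2 * Num.sqrt v), 2 * Num.sqrt v])
     (x ^+ n * semicircle_density v x).

Lemma continuous_density v : continuous (semicircle_density v).
Proof.
move=> x; rewrite /semicircle_density; apply: cvgM; last exact: cvg_cst.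
apply: (@continuous_comp _ _ _ (fun x => 4 * v - x ^+ 2) Num.sqrt); last exact: sqrt_continuous.
by apply: cvgB; [exact: cvg_cst|exact: exprn_continuous].
Qed.

Lemma continuous_density_expr v n : continuous (fun x => x ^+ n * semicircle_density v x).
Proof.
by move=> x; apply: cvgM; [exact: exprn_continuous|exact: continuous_density].
Qed.

Lemma density_ge0 v x : 0 < v -> 0 <= semicircle_density v x.
Proof.
by move=> v0; rewrite divr_ge0 ?sqrtr_ge0// !mulr_ge0 ?ltW// pi_gt0.
Qed.

(** The total mass is a hypothesis and is not computed: for an increment it is the moment of order
    0, equal to the trace of the unit. *)
Lemma semicircle_moment_le v n : 0 < v -> semicircle_moment v 0 = 1 ->
  `|semicircle_moment v n| <= (2 * Num.sqrt v) ^+ n.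
Proof.
move=> v0 m0; set a := 2 * Num.sqrt v.
have ia k : mu.-integrable `[-a, a] (EFin \o (fun x => x ^+ k * semicircle_density v x)).
  by apply: integrable_continuous; exact: continuous_density_expr.
apply: le_trans (le_normr_Rintegral _ (ia n)) _ => //.
apply: (@le_trans _ _ (\int[mu]_(x in `[-a, a]) (a ^+ n * (x ^+ 0 * semicircle_density v x)))).
  apply: le_Rintegral => //.
  - apply: (integrable_continuous (f := fun x => `|x ^+ n * semicircle_density v x|)) => x.
    by apply: cvg_norm; exact: continuous_density_expr.
  - apply: (integrable_continuous (f := fun x => a ^+ n * (x ^+ 0 * semicircle_density v x))) => x.
    by apply: cvgM; [exact: cvg_cst|exact: continuous_density_expr].
  - move=> x; rewrite /= in_itv /= => xa; rewrite normrM expr0 mul1r.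
    rewrite [X in _ * X]ger0_norm ?density_ge0//; apply: ler_wpM2r; first exact: density_ge0.
    by rewrite normrX; apply: lerXn2r; rewrite ?nnegrE ?mulr_ge0 ?sqrtr_ge0 ?ler_norml.
rewrite (RintegralZl _ _ (ia 0%N))//.
by rewrite [X in _ * X]m0 mulr1.
Qed.

(* [x ^ k (4 v - x ^ 2) ^ (3 / 2)] vanishes at both ends of the support; its
   derivative relates the moments. *)
Lemma semicircle_moment_rec v (k : nat) : 0 < v ->
  k%:R * (4 * v * semicircle_moment v k.-1 - semicircle_moment v k.+1)
   = 3 * semicircle_moment v k.+1.
Proof.
move=> v0; set a := 2 * Num.sqrt v; pose w x := 4 * v - x ^+ 2.
have a0 : 0 < a by rewrite mulr_gt0// sqrtr_gt0.
have aa : a ^+ 2 = 4 * v by rewrite exprMn sqr_sqrtr ?ltW// -natrX.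
pose G x := x ^+ k * (w x * (semicircle_density v x)).
pose g x := k%:R * (4 * v * (x ^+ k.-1 * semicircle_density v x)
   - x ^+ k.+1 * semicircle_density v x) - 3 * (x ^+ k.+1 * semicircle_density v x).
have cw : continuous w.
  by move=> x; apply: cvgB; [exact: cvg_cst|exact: exprn_continuous].
have cd n := @continuous_density_expr v n.
have cG : continuous G.
  move=> x; apply: cvgM; first exact: exprn_continuous.
  by apply: cvgM; [exact: cw|exact: continuous_density].
have cg : continuous g.
  move=> x; apply: cvgB; (apply: cvgM; first exact: cvg_cst); last exact: cd.
  apply: cvgB; last exact: cd.
  by apply: cvgM; [exact: cvg_cst|exact: cd].
have dG x : - a < x < a -> is_derive x 1 G (g x).
  move=> xa; have w0 : 0 < w x.
    rewrite /w -aa subr_gt0 -real_normK ?num_real//.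
    by rewrite ltrXn2r ?nnegrE ?(ltW a0) ?normr_ge0// ltr_norml.
  have dX n : is_derive x 1 (fun x => x ^+ n) (n%:R * x ^+ n.-1).
    have -> : (fun x => x ^+ n) = (@id R) ^+ n by rewrite exprfctE.
    by apply: is_derive_eq (is_deriveX n (is_derive_id x 1)) _; exact: mulr1.
  have dw : is_derive x 1 w (- (2 * x)).
    apply: is_derive_eq (is_deriveB (is_derive_cst (4 * v) x 1) (dX 2)) _.
    by rewrite sub0r.
  have dsw : is_derive x 1 (fun x => Num.sqrt (w x)) ((2 * Num.sqrt (w x))^-1 * - (2 * x)).
    exact: (is_derive1_comp (is_derive1_sqrt w0) dw).
  pose c := (2 * pi * v)^-1.
  have dd := is_deriveM dsw (is_derive_cst c x 1).
  apply: is_derive_eq (is_deriveM (dX k) (is_deriveM dw dd)) _.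
  set sw := Num.sqrt (w x); have sw0 : sw != 0 by rewrite gt_eqF// sqrtr_gt0.
  have swE : w x = sw ^+ 2 by rewrite sqr_sqrtr// ltW.
  rewrite /g /semicircle_density -/(w x) -/sw -/c.
  transitivity (x ^+ k * (c * (w x * (2 * sw)^-1) * - (2 * x) + sw * c * - (2 * x))
      + w x * (sw * c) * (k%:R * x ^+ k.-1)).
    rewrite -/sw -[RHS]/(x ^+ k * _ + _); congr (_ + _); congr (_ * _).
    change (w x * (sw * 0 + c * ((2 * sw)^-1 * - (2 * x))) + sw * c * - (2 * x) =
      c * (w x * (2 * sw)^-1) * - (2 * x) + sw * c * - (2 * x)); ring.
  (* The factor [w] absorbs the singularity of the derivative of its square root. *)
  have -> : w x * (2 * sw)^-1 = sw / 2 by rewrite swE; field.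
  rewrite /w; case: (k) => [|j] /=; first by rewrite expr0 expr1; field.
  by rewrite !exprS; field.
have i0 n : mu.-integrable `[-a, a] (EFin \o (fun x => x ^+ n * semicircle_density v x)).
  exact: integrable_continuous.
have naa : - a < a by rewrite -subr_gt0 opprK addr_gt0.
have := Rintegral_derive naa cG cg dG.
have -> : G a - G (- a) = 0 by rewrite /G /w sqrrN aa subrr !mul0r !mulr0 subrr.
have iZ r (f : R -> R) : mu.-integrable `[-a, a] (EFin \o f) ->
    mu.-integrable `[-a, a] (EFin \o (fun x => r * f x)).
  by move=> fi; have := integrableZl _ r fi; apply.
have iB (f h : R -> R) : mu.-integrable `[-a, a] (EFin \o f) ->
    mu.-integrable `[-a, a] (EFin \o h) ->
    mu.-integrable `[-a, a] (EFin \o (fun x => f x - h x)).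
  by move=> fi hi; have := integrableB _ fi hi; apply.
rewrite /g RintegralB//; last 2 first.
- by apply: (iZ _); apply: iB => //; exact: iZ.
- exact: iZ.
rewrite RintegralZl//; last by apply: iB => //; exact: iZ.
rewrite RintegralB//; last exact: iZ.
rewrite !RintegralZl// => /eqP; rewrite subr_eq0 => /eqP.
exact.
Qed.

Lemma semicircle_moment1 v : 0 < v -> semicircle_moment v 1 = 0.
Proof.
move=> v0; have := semicircle_moment_rec 0 v0; rewrite mul0r => /esym/eqP.
by rewrite mulf_eq0 pnatr_eq0 /= => /eqP.
Qed.

Lemma semicircle_moment2 v : 0 < v -> semicircle_moment v 0 = 1 ->
  semicircle_moment v 2 = v.
Proof.
move=> v0 m0; have := semicircle_moment_rec 1 v0; rewrite /= m0; lra.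
Qed.

End Semicircle.

(** * The operator algebra as a ring *)

Section OperatorAlgebra.
Context {R : realType} {H : completeNormedModType R[i]}.
Context (ip : {dot H for Num.conj}) (A : set (H -> H)) (F : R -> set (H -> H)).
Context (Phi : (H -> H) -> R[i]).

Lemma space_star (W : filtered_Wstar_space ip A F Phi) : star_algebra ip A.
Proof. by have [_ []] := W. Qed.

(* The algebra [A] as a type; the proof [W] makes it a ring. *)
Definition opalg (W : filtered_Wstar_space ip A F Phi) : Type :=
  {a : H -> H | `[< A a >]}.

HB.instance Definition _ W := Choice.copy (opalg W) {a : H -> H | `[< A a >]}.

Context {W : filtered_Wstar_space ip A F Phi}.
Local Notation T := (opalg W).
Implicit Types (a b c : T) (k : R[i]).

Definition op_of a : H -> H := sval a.

Lemma opalgP a : A (op_of a). Proof. exact/asboolP/(svalP a). Qed.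

Definition mkop (f : H -> H) (Af : A f) : T := exist _ f (asboolT Af).

Lemma op_of_inj a b : op_of a = op_of b -> a = b.
Proof. by case: a b => f p [g q] /= fg; subst g; congr exist; exact: bool_irrelevance. Qed.

Let Alin k f g : A f -> A g -> A (k *: f + g).
Proof. by have [_ _ h _ _] := space_star W; exact: h. Qed.

Let A1 : A idfun. Proof. by have [_ h _ _ _] := space_star W. Qed.

Let AM f g : A f -> A g -> A (f \o g).
Proof. by have [_ _ _ h _] := space_star W; exact: h. Qed.

Let AD f g : A f -> A g -> A (f + g).
Proof. by move=> Af Ag; rewrite -[f]scale1r; exact: Alin. Qed.

Let A0 : A 0.
Proof.
have -> : (0 : H -> H) = -1 *: idfun + idfun by rewrite scaleN1r addNr.
exact: Alin.
Qed.

Let AZ k f : A f -> A (k *: f).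
Proof. by move=> Af; rewrite -[k *: f]addr0; exact: Alin. Qed.

Let AN f : A f -> A (- f).
Proof. by move=> Af; rewrite -scaleN1r; exact: AZ. Qed.

Lemma op_linear a : linear (op_of a).
Proof. by have [h _ _ _ _] := space_star W; have [] := h _ (opalgP a). Qed.

Lemma op_ofD_arg a x y : op_of a (x + y) = op_of a x + op_of a y.
Proof. by rewrite -[x in LHS]scale1r op_linear scale1r. Qed.

Lemma op_of0_arg a : op_of a 0 = 0.
Proof. by apply: (addIr (op_of a 0)); rewrite -op_ofD_arg !add0r. Qed.

Lemma op_ofZ_arg a k x : op_of a (k *: x) = k *: op_of a x.
Proof. by rewrite -[k *: x]addr0 op_linear op_of0_arg addr0. Qed.

Let add a b : T := mkop (AD (opalgP a) (opalgP b)).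
Let opp a : T := mkop (AN (opalgP a)).
Let zero : T := mkop A0.
Let one : T := mkop A1.
Let mul a b : T := mkop (AM (opalgP a) (opalgP b)).
Let scale k a : T := mkop (AZ k (opalgP a)).

Let addA : associative add.
Proof. by move=> a b c; apply: op_of_inj; exact: addrA. Qed.
Let addC : commutative add.
Proof. by move=> a b; apply: op_of_inj; exact: addrC. Qed.
Let add0 : left_id zero add.
Proof. by move=> a; apply: op_of_inj; exact: add0r. Qed.
Let addN : left_inverse zero opp add.
Proof. by move=> a; apply: op_of_inj; exact: addNr. Qed.
Let mulA : associative mul.
Proof. by move=> a b c; exact: op_of_inj. Qed.
Let mul1 : left_id one mul.
Proof. by move=> a; exact: op_of_inj. Qed.
Let mulr1' : right_id one mul.
Proof. by move=> a; exact: op_of_inj. Qed.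
Let mulDl : left_distributive mul add.
Proof. by move=> a b c; exact: op_of_inj. Qed.
Let mulDr : right_distributive mul add.
Proof. by move=> a b c; apply: op_of_inj; apply/funext => x; exact: op_ofD_arg. Qed.
Let one0 : one != zero.
Proof.
apply/eqP => /(congr1 op_of) e; have PhiP := fspace_state W.
have h := state_linear PhiP (-1) A1 A1.
have : Phi 0 = 0 by rewrite -[RHS](addNr (Phi idfun)) -mulN1r -h scaleN1r addNr.
rewrite -[X in Phi X]e (state_unit PhiP) => /eqP.
by rewrite oner_eq0.
Qed.

HB.instance Definition _ := GRing.isNzRing.Build T
  addA addC add0 addN mulA mul1 mulr1' mulDl mulDr one0.

Let scaleA k l a : scale k (scale l a) = scale (k * l) a.
Proof. by apply: op_of_inj; exact: scalerA. Qed.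
Let scale1 : left_id 1 scale.
Proof. by move=> a; apply: op_of_inj; exact: scale1r. Qed.
Let scaleDr : right_distributive scale +%R.
Proof. by move=> k a b; apply: op_of_inj; exact: scalerDr. Qed.
Let scaleDl a : {morph scale^~ a : k l / k + l}.
Proof. by move=> k l; apply: op_of_inj; exact: scalerDl. Qed.

HB.instance Definition _ := GRing.Zmodule_isLmodule.Build R[i] T
  scaleA scale1 scaleDr scaleDl.

Let scaleAl k a b : k *: (a * b) = (k *: a) * b.
Proof. exact: op_of_inj. Qed.
HB.instance Definition _ := GRing.Lmodule_isLalgebra.Build R[i] T scaleAl.

Let scaleAr k a b : k *: (a * b) = a * (k *: b).
Proof.
apply: op_of_inj; apply/funext => x /=.
by rewrite -[RHS]/(op_of a (k *: op_of b x)) op_ofZ_arg.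
Qed.
HB.instance Definition _ := GRing.Lalgebra_isAlgebra.Build R[i] T scaleAr.

Lemma op_ofD a b : op_of (a + b) = op_of a + op_of b. Proof. by []. Qed.
Lemma op_ofN a : op_of (- a) = - op_of a. Proof. by []. Qed.
Lemma op_ofB a b : op_of (a - b) = op_of a - op_of b. Proof. by []. Qed.
Lemma op_of0 : op_of (0 : T) = 0. Proof. by []. Qed.
Lemma op_ofM a b : op_of (a * b) = op_of a \o op_of b. Proof. by []. Qed.
Lemma op_of1 : op_of (1 : T) = idfun. Proof. by []. Qed.
Lemma op_ofZ k a : op_of (k *: a) = k *: op_of a. Proof. by []. Qed.

Lemma op_of_sum (I : Type) (r : seq I) (f : I -> T) :
  op_of (\sum_(i <- r) f i) = \sum_(i <- r) op_of (f i).
Proof. exact: (big_morph op_of op_ofD op_of0). Qed.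

Lemma adj_exists a : exists b : T, is_adjoint ip (op_of a) (op_of b).
Proof.
have [_ _ _ _ h] := space_star W; have [b Ab adjb] := h _ (opalgP a).
by exists (mkop Ab).
Qed.

Definition opstar a : T := projT1 (cid (adj_exists a)).

Lemma opstarP a : is_adjoint ip (op_of a) (op_of (opstar a)).
Proof. by rewrite /opstar; case: cid. Qed.

Lemma op_of_star a : op_of (opstar a) = adj ip (op_of a).
Proof. by rewrite (adjE (opstarP a)). Qed.

Lemma opstar_unique a b : is_adjoint ip (op_of a) (op_of b) -> opstar a = b.
Proof. by move=> h; apply: op_of_inj; rewrite op_of_star (adjE h). Qed.

Definition optau a : R[i] := Phi (op_of a).

Lemma opalg_tracial : tracial_star opstar optau.
Proof.
have PhiP := fspace_state W.
split.
- move=> a b; apply: opstar_unique => x y.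
  rewrite -[LHS]/(ip (op_of a x + op_of b x) y).
  rewrite -[RHS]/(ip x (op_of (opstar a) y + op_of (opstar b) y)).
  by rewrite [LHS]linearDl [RHS]linearDr; congr (_ + _); exact: opstarP.
- move=> k a; apply: opstar_unique => x y.
  rewrite -[LHS]/(ip (k *: op_of a x) y) -[RHS]/(ip x (k^*%C *: op_of (opstar a) y)).
  rewrite [LHS]linearZl_LR [RHS]linearZr_LR; congr (_ * _).
    exact: esym (conjcK k).
  exact: opstarP.
- move=> a b; apply: opstar_unique => x y.
  by rewrite -[LHS]/(ip (op_of a (op_of b x)) y) [LHS]opstarP [LHS]opstarP.
- move=> a; apply: opstar_unique => x y.
  by rewrite hermC [RHS]hermC; congr (_ * Num.conj _); symmetry; exact: opstarP.
- move=> k a b; exact: (state_linear PhiP k (opalgP a) (opalgP b)).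
- exact: state_unit PhiP.
- move=> a b; exact: (state_tracial PhiP (opalgP a) (opalgP b)).
- by move=> a; rewrite /optau op_ofM op_of_star; exact: (state_positive PhiP (opalgP a)).
Qed.

Lemma nsq_l2sq a : nsq opstar optau a = l2sq ip Phi (op_of a).
Proof. by rewrite /nsq /retr /optau op_ofM op_of_star. Qed.

(** The value 0 outside [A] makes processes total, although they are known to lie in [A] at
    nonnegative times only. *)
Definition to_op (f : H -> H) : T :=
  if pselect (A f) is left Af then mkop Af else 0.

Lemma to_opK f : A f -> op_of (to_op f) = f.
Proof. by move=> Af; rewrite /to_op; case: pselect. Qed.

Definition opfilt (t : R) (a : T) : Prop := F t (op_of a).

Let filtP := fspace_filtration W.

Lemma opfilt_to_op t f : 0 <= t -> F t f -> opfilt t (to_op f).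
Proof. by move=> t0 Ff; rewrite /opfilt to_opK//; exact: (filtration_sub filtP t0). Qed.

Lemma opalg_filtration : is_star_filtration opstar opfilt.
Proof.
split.
- by move=> t t0; have [] := filtration_algebra filtP t0.
- move=> t a b t0 Fa Fb; have [_ _ h _ _] := filtration_algebra filtP t0.
  rewrite /opfilt op_ofB addrC -scaleN1r; exact: h.
- move=> t k a t0 Fa; have [_ h1 h _ _] := filtration_algebra filtP t0.
  rewrite /opfilt op_ofZ -[k *: _](addrNK idfun).
  have -> : k *: op_of a - idfun = k *: op_of a + (-1) *: idfun by rewrite scaleN1r.
  rewrite -addrA.
  by apply: (h _ _ _ Fa); exact: (h _ _ _ h1 h1).
- by move=> t a b t0 Fa Fb; have [_ _ _ h _] := filtration_algebra filtP t0; exact: h.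
- move=> t a t0 Fa; have [_ _ _ _ h] := filtration_algebra filtP t0.
  by have [b Fb ab] := h _ Fa; rewrite /opfilt op_of_star (adjE ab).
- by move=> s t a s0 st Fa; exact: (filtration_incr filtP s0 st).
Qed.

End OperatorAlgebra.
#[global] Arguments op_of : simpl never.

(** * Operator norm from moments *)

Section OperatorBound.
Context {R : realType} {T : algType R[i]} (star : T -> T) (tau : T -> R[i]).
Hypothesis tsP : tracial_star star tau.
Local Notation retr := (retr tau).
Local Notation nsq := (nsq star tau).
Local Notation nrm := (nrm star tau).

Lemma le1_of_expr_bounded (x B : R) : 0 <= x ->
  (forall k, x ^+ (2 ^ k)%N <= B) -> x <= 1.
Proof.
move=> x0 h; rewrite leNgt; apply/negP => x1.
have bern n : 1 + n%:R * (x - 1) <= x ^+ n.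
  elim: n => [|n IH]; first by rewrite mul0r addr0.
  have n0 : 0 <= n%:R :> R by exact: ler0n.
  have n2 : 0 <= n%:R * (x - 1) ^+ 2 by rewrite mulr_ge0 ?sqr_ge0.
  by have := ler_wpM2l x0 IH; rewrite exprS -natr1; nra.
have [n nB] : exists n : nat, B < n%:R * (x - 1).
  have x10 : 0 < x - 1 by rewrite subr_gt0.
  exists (Num.truncn (`|B| / (x - 1))).+1.
  rewrite -ltr_pdivrMr//; apply: le_lt_trans (truncnS_gt _).
  by rewrite ler_pM2r ?invr_gt0// ler_norm.
have := h n; apply/negP; rewrite -ltNge; apply: lt_le_trans (bern _).
apply: (lt_le_trans nB); apply: (@le_trans _ _ ((2 ^ n)%:R * (x - 1)));
  last by rewrite lerDr.
by rewrite ler_pM2r ?subr_gt0// ler_nat ltnW// ltn_expl.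
Qed.

(* Repeated squaring in the Cauchy-Schwarz inequality: the moments of [D] of
   order [2 ^ k] control the operator norm of [D]. *)
Lemma opbound_of_moments (D : T) (c : R) : 0 < c -> star D = D ->
  (forall n, retr (D ^+ n) <= c ^+ n) -> opbound star tau c D.
Proof.
move=> c0 sD mD; suff h a : nsq (D * a) <= c ^+ 2 * nsq a.
  by apply: (opbound_half tsP) => //; [exact: ltW|rewrite sD].
have sDn n : star (D ^+ n) = D ^+ n.
  elim: n => [|n IH]; first by rewrite expr0 (star1 tsP).
  by rewrite exprS (starM tsP) IH sD -[in RHS]exprS [RHS]exprSr.
pose u k := retr (star a * (D ^+ (2 ^ k.+1)%N * a)).
have uE k : nsq (D ^+ (2 ^ k)%N * a) = u k.
  rewrite /nsq (starM tsP) sDn /u -mulrA (mulrA (D ^+ _)) -exprD addnn.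
  by rewrite -mul2n -expnS.
have u0E : nsq (D * a) = u 0%N by rewrite -uE expn0 expr1.
have u_ge0 k : 0 <= u k by rewrite -uE nsq_ge0.
have N0 := nsq_ge0 tsP a.
have uS k : u k ^+ 2 <= nsq a * u k.+1.
  by rewrite -(uE k.+1); exact: (retr_CS2 tsP).
(* Cyclicity gathers [a * star a] into one factor independent of [k], and the other factor is a
   moment of [D]. *)
have uB k : u k <= c ^+ (2 ^ k.+1)%N * nrm (a * star a).
  rewrite /u mulrA (retr_comm tsP) mulrA (retr_comm tsP).
  apply: le_trans (ler_norm _) _; apply: le_trans (retr_CS tsP _ _) _.
  apply: ler_wpM2r; first exact: nrm_ge0.
  rewrite (nrm_le tsP) ?exprn_ge0 ?(ltW c0)// /nsq sDn -exprD -exprM muln2 -addnn.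
  exact: mD.
rewrite u0E; move: N0; rewrite le0r => /predU1P[N0|N0].
  have := uS 0%N; rewrite N0 mul0r => h; rewrite mulr0.
  by have := u_ge0 0%N; nra.
have cN k : 0 < c ^+ (2 ^ k)%N * nsq a by rewrite mulr_gt0 ?exprn_gt0.
(* The ratio to be bounded by 1: by [uS] and [uB] its powers of order [2 ^ k] stay below a
   constant. *)
pose x := u 0%N / (c ^+ 2 * nsq a).
have cN2 : 0 < c ^+ 2 * nsq a by rewrite mulr_gt0 ?exprn_gt0.
have x0 : 0 <= x by rewrite divr_ge0// ltW.
have xu k : x ^+ (2 ^ k)%N <= u k / (c ^+ (2 ^ k.+1)%N * nsq a).
  elim: k => [|k IH]; first by rewrite expn0 expn1 expr1.
  rewrite expnSr exprM; apply: (@le_trans _ _ ((u k / (c ^+ (2 ^ k.+1)%N * nsq a)) ^+ 2)).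
    by rewrite ler_pXn2r ?nnegrE ?exprn_ge0// divr_ge0// ltW.
  have -> : u k.+1 / (c ^+ (2 ^ k.+2)%N * nsq a) =
      (nsq a * u k.+1) / (c ^+ (2 ^ k.+1)%N * nsq a) ^+ 2.
    rewrite (expnSr 2 k.+1) exprM; set d := c ^+ _.
    by field; rewrite !gt_eqF// exprn_gt0.
  by rewrite expr_div_n ler_pM2r ?invr_gt0 ?exprn_gt0.
suff : x <= 1 by rewrite /x ler_pdivrMr// mul1r.
apply: (le1_of_expr_bounded (B := nrm (a * star a) / nsq a)) => // k.
apply: le_trans (xu k) _; rewrite ler_pdivrMr//.
by apply: le_trans (uB k) _; rewrite mulrCA divfK ?gt_eqF// mulrC.
Qed.

End OperatorBound.

Lemma quad_expand (K : comNzRingType) (T : algType K) (D a b : T) (x y : K) :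
  D * (a + x *: 1) * D * (b + y *: 1) = D * (a * (D * b)) + y *: (D * (a * D))
    + (x *: (D * D * b) + (y * x) *: (D * D)).
Proof.
rewrite mulrDr -scalerAr mulr1 (mulrDr D) -scalerAr mulr1 !mulrDl -!scalerAl.
by rewrite scalerDr !scalerA !mulrA addrACA.
Qed.

(** * From vanishing alternating products to mean and covariance *)

Section FreeIncrements.
Context {R : realType} {T : algType R[i]} (star : T -> T) (tau : T -> R[i]).
Hypothesis tsP : tracial_star star tau.
Context (S : T -> Prop) (D : T) (v : R).
Hypothesis S1 : S 1.
Hypothesis SB : forall k a b, S a -> S b -> S (a - k *: b).
Hypothesis tauD0 : tau D = 0.
Hypothesis tauD2 : tau (D * D) = v%:C.
Hypothesis free2 : forall a, S a -> tau a = 0 -> tau (D * a) = 0.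
Hypothesis free2' : forall a, S a -> tau a = 0 ->
  tau ((D * D - v%:C *: 1) * a) = 0.
Hypothesis free4 : forall a b, S a -> tau a = 0 -> S b -> tau b = 0 ->
  tau (D * (a * (D * b))) = 0.

Let cent a : a = (a - tau a *: 1) + tau a *: 1. Proof. by rewrite subrK. Qed.
Let Scent a : S a -> S (a - tau a *: 1). Proof. by move=> Sa; exact: SB. Qed.
Let tau_cent a : tau (a - tau a *: 1) = 0.
Proof. by rewrite (tauB tsP) (tauZ tsP) (tau1 tsP) mulr1 subrr. Qed.

Lemma tau_free_mean a : S a -> tau (D * a) = 0.
Proof.
move=> Sa; rewrite [a]cent mulrDr (tauD tsP) free2 ?tau_cent//; last exact: Scent.
by rewrite -scalerAr mulr1 (tauZ tsP) tauD0 mulr0 addr0.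
Qed.

(** Both [a] and [b] are split into a centred part and a scalar. Freeness kills the word with two
    centred parts, the centred square [D * D - v] kills those with one, and the scalars leave
    [v * tau a * tau b]. *)
Lemma tau_free_cov a b : S a -> S b ->
  tau (D * a * D * b) = v%:C * (tau a * tau b).
Proof.
have sq c : S c -> tau c = 0 -> tau (D * D * c) = 0.
  move=> Sc c0; have := free2' Sc c0.
  by rewrite mulrBl (tauB tsP) -scalerAl mul1r (tauZ tsP) c0 mulr0 subr0.
move=> Sa Sb; set a0 := a - tau a *: 1; set b0 := b - tau b *: 1.
have Sa0 := Scent Sa; have Sb0 := Scent Sb.
have ta := tau_cent a; have tb := tau_cent b.
have := quad_expand D a0 b0 (tau a) (tau b); rewrite -!cent => ->.
rewrite !(tauD tsP) !(tauZ tsP) free4// sq// (tau_comm tsP D (a0 * D)) -mulrA.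
by rewrite (tau_comm tsP a0) sq// tauD2 !mulr0 !add0r mulrC [tau b * _]mulrC.
Qed.

End FreeIncrements.

Section Bridge.
Context {R : realType} {H : completeNormedModType R[i]}.
Context (ip : {dot H for Num.conj}) (A : set (H -> H)) (F : R -> set (H -> H)).
Context (Phi : (H -> H) -> R[i]) (W : filtered_Wstar_space ip A F Phi).
Context (X : R -> H -> H) (XP : free_brownian_motion ip F Phi X).
Local Notation T := (opalg W).
Local Notation star := (@opstar _ _ _ _ _ _ W).
Local Notation tau := (@optau _ _ _ _ _ _ W).
Local Notation toT := (@to_op _ _ _ _ _ _ W).
Local Notation opF := (@opfilt _ _ _ _ _ _ W).
Let tsP : tracial_star star tau := @opalg_tracial _ _ _ _ _ _ W.
Let filtP := fspace_filtration W.
Let sfP : is_star_filtration star opF := @opalg_filtration _ _ _ _ _ _ W.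

Let AX t : 0 <= t -> A (X t).
Proof. by move=> t0; exact: (filtration_sub filtP t0 (fbm_adapted XP t0)). Qed.

Lemma op_of_exp (a : T) n : op_of (a ^+ n) = iter n (op_of a).
Proof.
elim: n => [|n IH]; first by apply/funext.
by rewrite exprS op_ofM IH; apply/funext.
Qed.

Lemma alg_gen_sub (S : set (H -> H)) : S `<=` alg_gen ip S.
Proof. by move=> a Sa B _; apply. Qed.

Let incr s t : T := toT (X t) - toT (X s).

Let incrE s t : 0 <= s -> 0 <= t -> op_of (incr s t) = X t - X s.
Proof. by move=> s0 t0; rewrite /incr op_ofB !to_opK//; exact: AX. Qed.

(** Freeness read on words that start with the increment: even positions hold its algebra, odd ones
    the past. *)
Let free_at s t (n : nat) (a : seq T) : 0 <= s -> s < t -> size a = n.+1 ->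
  (forall i, (i <= n)%N -> alg_gen ip (if ~~ odd i then [set X t - X s] else F s) (op_of a`_i)) ->
  (forall i, (i <= n)%N -> tau a`_i = 0) ->
  tau (\prod_(x <- a) x) = 0.
Proof.
move=> s0 st sa ga ta.
have := fbm_free XP s0 st (n := n) (c := fun i => ~~ odd i) (a := fun i => op_of a`_i).
rewrite /optau => h; rewrite -[RHS]h.
- rewrite (big_nth 0) sa big_mkord.
  congr Phi; apply: (big_ind2 (fun (x : T) f => op_of x = f)) => // x f y g <- <-.
  by rewrite op_ofM.
- by move=> i _ /=; case: (odd i).
- by move=> i hi; split; [exact: ga|exact: ta].
Qed.

Let tau_incr_exp s t n : 0 <= s -> s < t ->
  tau (incr s t ^+ n) = (semicircle_moment (t - s) n)%:C.
Proof.
move=> s0 st; have t0 : 0 <= t by rewrite (le_trans s0)// ltW.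
have [_ h] := fbm_semicircular XP s0 st.
by rewrite /optau op_of_exp incrE// h.
Qed.

Lemma opalg_free_bm : is_free_bm star tau opF (fun t => toT (X t)).
Proof.
have sX t : 0 <= t -> star (toT (X t)) = toT (X t).
  move=> t0; apply: opstar_unique; rewrite !to_opK; try exact: AX.
  exact: (fbm_self_adjoint XP t0).
have FX t : 0 <= t -> opF t (toT (X t)).
  by move=> t0; apply: opfilt_to_op => //; exact: fbm_adapted XP _ t0.
have incr_facts s t : 0 <= s -> s < t ->
    [/\ tau (incr s t) = 0, tau (incr s t * incr s t) = (t - s)%:C &
     forall n, retr tau (incr s t ^+ n) <= (2 * Num.sqrt (t - s)) ^+ n].
  move=> s0 st; have v0 : 0 < t - s by rewrite subr_gt0.
  have m0 : semicircle_moment (t - s) 0 = 1.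
    by have := tau_incr_exp 0 s0 st; rewrite expr0 (tau1 tsP) => -[].
  split.
  - by rewrite -[incr s t]expr1 tau_incr_exp// semicircle_moment1.
  - by rewrite -expr2 tau_incr_exp// semicircle_moment2.
  - move=> n; rewrite /retr tau_incr_exp//=; apply: le_trans (ler_norm _) _.
    exact: semicircle_moment_le.
have F1 s : 0 <= s -> opF s 1 := sf1 sfP (t := s).
have FB s k a b : 0 <= s -> opF s a -> opF s b -> opF s (a - k *: b).
  by move=> s0 Fa Fb; apply: (sfB sfP) => //; exact: (sfZ sfP).
have gF s t a : 0 <= s -> s < t -> opF s a ->
    alg_gen ip (F s) (op_of a) by move=> s0 st Fa; exact: alg_gen_sub.
have gD s t : 0 <= s -> s < t -> alg_gen ip [set X t - X s] (op_of (incr s t)).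
  by move=> s0 st; apply: alg_gen_sub; rewrite incrE// (le_trans s0)// ltW.
have free2 s t d a : 0 <= s -> s < t -> alg_gen ip [set X t - X s] (op_of d) ->
    tau d = 0 -> opF s a -> tau a = 0 -> tau (d * a) = 0.
  move=> s0 st gd d0 Fa a0; have := free_at (n := 1) (a := [:: d; a]) s0 st.
  rewrite !big_cons big_nil mulr1; apply => //.
    by case=> [|[|i]] // _; exact: (gF s t).
  by case=> [|[|i]].
have free4 s t a b : 0 <= s -> s < t -> opF s a -> tau a = 0 -> opF s b -> tau b = 0 ->
    tau (incr s t * (a * (incr s t * b))) = 0.
  move=> s0 st Fa a0 Fb b0; have [d0 _ _] := incr_facts s t s0 st.
  have := free_at (n := 3) (a := [:: incr s t; a; incr s t; b]) s0 st.
  rewrite !big_cons big_nil mulr1; apply => //.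
    by case=> [|[|[|[|i]]]] // _; by [exact: gD|exact: (gF s t)].
  by case=> [|[|[|[|i]]]].
have free2D s t a : 0 <= s -> s < t -> opF s a -> tau a = 0 ->
    tau (incr s t * a) = 0.
  move=> s0 st Fa a0; have [d0 _ _] := incr_facts s t s0 st.
  by apply: (free2 s t) => //; exact: gD.
have free2D2 s t a : 0 <= s -> s < t -> opF s a -> tau a = 0 ->
    tau ((incr s t * incr s t - (t - s)%:C *: 1) * a) = 0.
  move=> s0 st Fa a0; have [_ d2 _] := incr_facts s t s0 st.
  apply: (free2 s t) => //; last first.
    by rewrite (tauB tsP) (tauZ tsP) (tau1 tsP) mulr1 d2 subrr.
  (* The centred square of the increment lies in the algebra generated by the increment, so freeness
     applies to it as a single letter. *)
  move=> B BP DB; have [_ B1 Blin BM _] := BP.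
  have BD := gD s t s0 st B BP DB.
  rewrite op_ofB addrC -op_ofN -scaleNr; apply: Blin => //; exact: BM.
split=> //.
- move=> s t a s0 st Fa; have [d0 d2 _] := incr_facts s t s0 st.
  apply: (tau_free_mean tsP (S := opF s)) => //; first exact: F1.
    by move=> *; exact: FB.
  by move=> *; exact: free2D.
- move=> s t a b s0 st Fa Fb; have [d0 d2 _] := incr_facts s t s0 st.
  apply: (tau_free_cov tsP (S := opF s)) => //.
  + exact: F1.
  + by move=> *; exact: FB.
  + by move=> *; exact: free2D2.
  + by move=> *; exact: free4.
- move=> s t s0 st; have [d0 d2 dn] := incr_facts s t s0 st.
  have t0 : 0 <= t by rewrite (le_trans s0)// ltW.
  apply: (opbound_of_moments tsP) => //; first by rewrite mulr_gt0// sqrtr_gt0 subr_gt0.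
  by rewrite (starB tsP) !sX.
Qed.

End Bridge.

(** * Simple processes as lists of steps *)

Section PartitionSteps.
Context {R : realType} {T : algType R[i]}.

Definition partition_steps (n : nat) (u : nat -> R) (v : nat -> T) : seq (R * R * T) :=
  [seq ((u i, u i.+1), v i) | i <- iota 0 n].

Lemma partition_steps_in n u v :
  (forall i j, (i <= j)%N -> (j <= n)%N -> u i <= u j) ->
  steps_in (u 0%N) (u n) (partition_steps n u v).
Proof.
move=> hu e /mapP[k]; rewrite mem_iota add0n => /andP[_ iV] -> /=.
by split; apply: hu => //; exact: ltnW.
Qed.

Lemma partition_steps_adapted (F : R -> T -> Prop) n u v :
  (forall i, (i < n)%N -> F (u i) (v i)) -> adapted F (partition_steps n u v).
Proof. by move=> hF e /mapP[k]; rewrite mem_iota add0n => /andP[_ /hF h] ->. Qed.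

End PartitionSteps.

Section L2Bridge.
Context {R : realType} {H : completeNormedModType R[i]}.
Context (ip : {dot H for Num.conj}) (A : set (H -> H)) (F : R -> set (H -> H)).
Context (Phi : (H -> H) -> R[i]) (W : filtered_Wstar_space ip A F Phi).
Local Notation T := (opalg W).
Local Notation star := (@opstar _ _ _ _ _ _ W).
Local Notation tau := (@optau _ _ _ _ _ _ W).
Local Notation toT := (@to_op _ _ _ _ _ _ W).
Local Notation opF := (@opfilt _ _ _ _ _ _ W).
Let filtP := fspace_filtration W.
Let sfP : is_star_filtration star opF := @opalg_filtration _ _ _ _ _ _ W.
Implicit Types V : @simple_process R H.

Let steps V := partition_steps (sp_size V) (sp_time V) (fun i => toT (sp_val V i)).

Let sp_time_mono V i j : simple_adapted F V -> (i <= j)%N -> (j <= sp_size V)%N ->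
  sp_time V i <= sp_time V j.
Proof.
move=> [_ hm _] /subnK <-; elim: (j - i)%N => [//|d IH]; rewrite addSn => hd.
by apply: le_trans (IH (ltnW hd)) _; exact: hm.
Qed.

Let steps_inV V : simple_adapted F V ->
  steps_in (sp_time V 0) (sp_time V (sp_size V)) (steps V).
Proof. by move=> aV; apply: partition_steps_in => i j; exact: sp_time_mono. Qed.

Let sp_val_in V i : simple_adapted F V -> (i < sp_size V)%N ->
  0 <= sp_time V i /\ A (sp_val V i).
Proof.
move=> aV iV; have [h0 _ hF] := aV.
have t0 : 0 <= sp_time V i.
  by apply: le_trans h0 _; apply: sp_time_mono => //; exact: ltnW.
by split => //; exact: (filtration_sub filtP t0 (hF _ iV)).
Qed.

Let steps_adapted V : simple_adapted F V -> adapted opF (steps V).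
Proof.
move=> aV; apply: partition_steps_adapted => i iV.
have [h0 hm hF] := aV; have [t0 _] := sp_val_in aV iV.
by apply: opfilt_to_op => //; exact: hF.
Qed.

Let steps_val V r : simple_adapted F V -> op_of (step_val (steps V) r) = simple_at V r.
Proof.
move=> aV; rewrite /step_val /simple_at big_map op_of_sum -(big_mkord xpredT
  (fun i => if sp_time V i <= r < sp_time V i.+1 then sp_val V i else 0)).
rewrite /index_iota subn0 big_seq [RHS]big_seq; apply: eq_bigr => i.
rewrite mem_iota add0n => /andP[_ iV]; case: ifP => _ //.
by rewrite to_opK//; have [] := sp_val_in aV iV.
Qed.

Let steps_int V Z (Z' : R -> T) t : simple_adapted F V -> 0 <= t ->
  (forall s, 0 <= s -> op_of (Z' s) = Z s) ->
  op_of (step_int Z' (step_clip 0 t (steps V))) = simple_integral Z V t.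
Proof.
move=> aV t0 ZZ; rewrite /step_int /simple_integral !big_map op_of_sum -(big_mkord xpredT
  (fun i => (Z (Num.min t (sp_time V i.+1)) - Z (Num.min t (sp_time V i))) \o sp_val V i)).
rewrite /index_iota subn0 big_seq [RHS]big_seq; apply: eq_bigr => i.
rewrite mem_iota add0n => /andP[_ iV] /=; have [h0 hm hF] := aV.
have [ti0 Av] := sp_val_in aV iV; have ti1 := le_trans ti0 (hm _ iV).
have cl x : 0 <= x -> clip 0 t x = Num.min t x.
  by move=> x0; rewrite /clip max_r// le_min t0 x0.
rewrite !cl// op_ofM op_ofB to_opK// !ZZ// le_min t0.
  by rewrite ti0.
by rewrite ti1.
Qed.

Lemma opalg_L2_integral Z U (Z' U' : R -> T) t (I : H -> H) :
  0 <= t -> A I ->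
  (forall s, 0 <= s -> op_of (Z' s) = Z s) ->
  (forall s, 0 <= s -> op_of (U' s) = U s) ->
  is_L2_integral ip F Phi Z U t I -> L2_integral star tau opF Z' U' t (toT I).
Proof.
move=> t0 AI ZZ UU [V [aV mV iV nV]] e e0.
have e0' : (0 < e%:E)%E by rewrite lte_fin.
have [k [ik nk]] : exists k, (\int[lebesgue_measure]_(s in `[0%R, t])
    (l2sq ip Phi (simple_at (V k) s - U s))%:E <= e%:E)%E /\
    l2sq ip Phi (simple_integral Z (V k) t - I) <= e.
  have /fine_cvgP[fi fl] := iV.
  have [N _ hN] := filterI fi (filterI (cvgr_lt _ fl _ e0) (cvgr_lt _ nV _ e0)).
  have [a [b c]] := hN N (leqnn N); exists N; split; last exact: ltW.
  by rewrite -(fineK a) lee_fin; exact: ltW.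
(* Clipping at [t] reproduces the minima with [t] in [simple_integral] and keeps the values on [[0,
   t[]. *)
pose L := step_clip 0 t (steps (V k)).
have l2E r : 0 <= r -> l2sq ip Phi (simple_at (V k) r - U r) =
    nsq star tau (step_val (steps (V k)) r - U' r).
  by move=> r0; rewrite nsq_l2sq op_ofB steps_val// UU.
have val_eq r : 0 <= r < t -> nsq star tau (step_val L r - U' r) =
    l2sq ip Phi (simple_at (V k) r - U r).
  by move=> rt; rewrite step_val_clip// l2E//; case/andP: rt.
have s0 : 0 <= sp_time (V k) 0%N by have [] := aV k.
have sub : (`[0, t[ : set R) `<=` `[0, t].
  by move=> r; rewrite /= !in_itv /= => /andP[-> /ltW ->].
exists L; split.
- exact: steps_in_clip t0 (steps_inV (aV k)).
- exact: (adapted_clip sfP) s0 t0 (steps_inV (aV k)) (steps_adapted (aV k)).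
- apply: (eq_measurable_fun (fun r => l2sq ip Phi (simple_at (V k) r - U r))).
    by move=> r; rewrite inE /= in_itv /= => /val_eq.
  exact: measurable_funS (mV k).
- apply: le_trans ik.
  have -> : (\int[lebesgue_measure]_(r in `[0%R, t[) (nsq star tau (step_val L r - U' r))%:E)%E =
      (\int[lebesgue_measure]_(r in `[0%R, t[) (l2sq ip Phi (simple_at (V k) r - U r))%:E)%E.
    by apply: eq_integral => r; rewrite inE /= in_itv /= => /val_eq ->.
  apply: ge0_subset_integral => //; first by apply/measurable_EFinP; exact: (mV k).
  move=> r; rewrite /= in_itv /= lee_fin => /andP[r0 _].
  by rewrite l2E//; exact: nsq_ge0 (@opalg_tracial _ _ _ _ _ _ W) _.
- by rewrite nsq_l2sq op_ofB (steps_int (aV k) t0 ZZ) to_opK.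
Qed.

End L2Bridge.

(** * Differential equations on the half-line *)

Section HalfLine.
Context {R : realType}.
Implicit Types (f g : R -> R) (t s h e : R).
Local Notation mu := (@lebesgue_measure R).
Local Notation ext f := (fun s : R => f (Num.max 0 s)).

Lemma sqrt_small (K e : R) : 0 <= K -> 0 < e ->
  exists2 d, 0 < d & forall h, 0 <= h -> h < d -> K * Num.sqrt h <= e.
Proof.
move=> K0 e0; have K1 : 0 < K + 1 by lra.
exists ((e / (K + 1)) ^+ 2) => [|h h0 hd]; first by rewrite exprn_gt0// divr_gt0.
have : Num.sqrt h <= e / (K + 1).
  apply: le_trans (ler_wsqrtr (ltW hd)) _.
  by rewrite sqrtr_sqr ger0_norm// divr_ge0 ?(ltW e0) ?(ltW K1).
by rewrite ler_pdivlMr// mulrC; have := sqrtr_ge0 h; nra.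
Qed.

Let max0_lip (a b : R) : `|Num.max 0 a - Num.max 0 b| <= `|a - b|.
Proof.
rewrite ler_norml; have := ler_norm (a - b); have := ler_norm (b - a).
by rewrite [`|b - a|]distrC; case: (leP 0 a); case: (leP 0 b); lra.
Qed.

Lemma continuous_holder f (K : R) : 0 <= K ->
  (forall t h, 0 <= t -> 0 < h -> h <= 1 -> `|f (t + h) - f t| <= K * Num.sqrt h) ->
  continuous (ext f).
Proof.
move=> K0 hf t; apply/cvgrPdist_le => e e0; have [d d0 hd] := sqrt_small K0 e0.
have key a b : 0 <= a -> 0 <= b -> `|a - b| < Num.min 1 d -> `|f a - f b| <= e.
  wlog ab : a b / a <= b.
    move=> H a0 b0; have [ab|ba] := leP a b; first exact: H.
    by rewrite distrC [`|f a - _|]distrC; apply: H => //; exact: ltW.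
  move=> a0 b0; rewrite distrC ger0_norm ?subr_ge0// lt_min => /andP[ab1 abd].
  have := ab; rewrite le_eqVlt => /predU1P[->|lt]; first by rewrite subrr normr0 ltW.
  rewrite distrC -[b in f b](subrKC a); apply: le_trans (hf _ _ a0 _ (ltW ab1)) _.
    by rewrite subr_gt0.
  by apply: hd; rewrite ?subr_ge0.
exists (Num.min 1 d) => /=; first by rewrite lt_min ltr01.
move=> s /= st; apply: key; rewrite ?le_max ?lexx//.
by apply: le_lt_trans st; exact: max0_lip.
Qed.

(** The hypothesis looks forward only. For [s < t] the quotient is based at [s], hence close to
    [g s], and the continuity of [g] leads to [g t]; each step costs [e / 2]. *)
Let quotient_close f g (K : R) t e : 0 <= K ->
  (forall t h, 0 <= t -> 0 < h -> h <= 1 ->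
     `|f (t + h) - f t - h * g t| <= K * (h * Num.sqrt h)) ->
  continuous (ext g) -> 0 <= t -> 0 < e ->
  exists2 d, 0 < d & forall s, 0 <= s -> s != t -> `|t - s| < d ->
    `|g t - (f s - f t) / (s - t)| <= e.
Proof.
move=> K0 hf cg t0 e0; have e2 : 0 < e / 2 by rewrite divr_gt0.
have [d1 d10 hd1] := sqrt_small K0 e2.
have /cvgrPdist_le /(_ _ e2) [d2 /= d20 hd2] := cg t.
have fwd a b : 0 <= a -> a < b -> b - a < Num.min 1 d1 ->
    `|g a - (f b - f a) / (b - a)| <= e / 2.
  rewrite lt_min => a0 ab /andP[ab1 abd]; have ba0 : 0 < b - a by rewrite subr_gt0.
  have := hf a (b - a) a0 ba0 (ltW ab1); rewrite subrKC distrC => h.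
  have -> : g a - (f b - f a) / (b - a) = ((b - a) * g a - (f b - f a)) / (b - a).
    by field; rewrite gt_eqF.
  rewrite normrM [`|_^-1|]ger0_norm ?invr_ge0 ?(ltW ba0)// ler_pdivrMr//.
  apply: (le_trans h); rewrite mulrCA mulrC; apply: ler_wpM2r; first exact: ltW.
  by apply: hd1 => //; exact: ltW.
exists (Num.min (Num.min 1 d1) d2); first by rewrite !lt_min ltr01 d10.
move=> s s0; rewrite lt_min neq_lt => /orP[st|ts] /andP[h1 h2].
  rewrite -[(f s - f t) / _]mulrNN -invrN !opprB.
  have hs : `|g s - (f t - f s) / (t - s)| <= e / 2.
    by apply: fwd => //; apply: le_lt_trans h1; exact: ler_norm.
  have := hd2 s h2; rewrite !max_r// => hg.
  rewrite -(subrKA (g s)); apply: le_trans (ler_normD _ _) _; lra.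
have : `|g t - (f s - f t) / (s - t)| <= e / 2.
  by apply: fwd => //; apply: le_lt_trans h1; rewrite distrC; exact: ler_norm.
move=> /le_trans; apply; lra.
Qed.

Lemma halfline_ode f g (K1 K : R) : 0 <= K1 -> 0 <= K ->
  (forall t h, 0 <= t -> 0 < h -> h <= 1 -> `|f (t + h) - f t| <= K1 * Num.sqrt h) ->
  (forall t h, 0 <= t -> 0 < h -> h <= 1 ->
     `|f (t + h) - f t - h * g t| <= K * (h * Num.sqrt h)) ->
  continuous (ext g) -> forall t, 0 <= t ->
  is_derive_halfline f t (g t) /\ f t = f 0 + \int[mu]_(s in `[0, t]) g s.
Proof.
move=> K10 K0 hf1 hf cg t t0; split.
  apply/cvgrPdist_le => e e0.
  have [d d0 hd] := quotient_close K0 hf cg t0 e0.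
  rewrite near_withinE; exists d => //= s /= std st s0.
  exact: hd.
move: t0; rewrite le_eqVlt => /predU1P[<-|t0].
  by rewrite set_itv1 Rintegral_set1 addr0.
have -> : \int[mu]_(s in `[0, t]) g s = \int[mu]_(s in `[0, t]) (ext g) s.
  by apply: eq_Rintegral => s; rewrite inE /= in_itv /= => /andP[s0 _]; rewrite max_r.
suff dF x : 0 < x < t -> is_derive x 1 (ext f) (ext g x).
  rewrite (Rintegral_derive t0 (continuous_holder K10 hf1) cg dF) maxxx.
  by rewrite (max_r (ltW t0)) addrC subrK.
move=> /andP[x0 xt]; rewrite (max_r (ltW x0)).
have lim : (fun h => h^-1 *: (f (Num.max 0 (h *: 1 + x)) - f (Num.max 0 x))) @ 0^' --> g x.
  apply/cvgrPdist_le => e e0.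
  have [d d0 hd] := quotient_close K0 hf cg (ltW x0) e0.
  (* A radius at most [x] keeps [h + x] nonnegative, where [ext f] is [f]. *)
  exists (Num.min d x) => /=; first by rewrite lt_min d0.
  move=> h /=; rewrite sub0r normrN lt_min => /andP[h1 h2] hn.
  have hx : 0 <= h + x by have := ler_norm (- h); rewrite normrN; lra.
  rewrite [h *: 1]mulr1 !max_r ?(ltW x0)//.
  have := hd (h + x) hx; rewrite addrK -subr_eq0 addrK => /(_ hn).
  by rewrite opprD addrCA subrr addr0 normrN => /(_ h1); rewrite [_ / h]mulrC.
by split; [apply/cvg_ex; exists (g x)|exact: cvg_lim lim].
Qed.

Lemma integrable_halfline f t : continuous (ext f) ->
  mu.-integrable `[0, t] (EFin \o f).
Proof.
move=> cf; apply: eq_integrable (integrable_continuous 0 t cf) => //.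
by move=> s; rewrite inE /= in_itv /= => /andP[s0 _]; rewrite max_r.
Qed.

Lemma continuous_sum (J : Type) (r : seq J) (f : J -> R -> R) :
  (forall j, continuous (f j)) -> continuous (fun s => \sum_(j <- r) f j s).
Proof.
move=> cf; elim: r => [|j r IH].
  have -> : (fun s => \sum_(j <- [::]) f j s) = cst 0.
    by apply/funext => s; rewrite big_nil.
  exact: cst_continuous.
have -> : (fun s => \sum_(i <- j :: r) f i s) = (fun s => f j s + \sum_(i <- r) f i s).
  by apply/funext => s; rewrite big_cons.
by move=> s; apply: cvgD; [exact: cf|exact: IH].
Qed.

Lemma Rintegral_sum_halfline (J : Type) (r : seq J) (f : J -> R -> R) t :
  (forall j, continuous (ext (f j))) ->
  \int[mu]_(s in `[0, t]) (\sum_(j <- r) f j s) =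
  \sum_(j <- r) \int[mu]_(s in `[0, t]) f j s.
Proof.
move=> cf; elim: r => [|j r IH].
  rewrite big_nil; under eq_Rintegral do rewrite big_nil.
  by rewrite Rintegral_cst//= mul0r.
rewrite big_cons -IH; under eq_Rintegral do rewrite big_cons.
rewrite RintegralD//; first exact: integrable_halfline.
by apply: integrable_halfline; apply: continuous_sum.
Qed.

Lemma moment_hierarchy (m : nat -> R -> R) (theta c : R) :
  (forall n, exists2 K : R, 0 <= K & forall t h, 0 <= t -> 0 < h -> h <= 1 ->
    `|m n (t + h) - m n t| <= K * Num.sqrt h) ->
  (forall n, exists2 K : R, 0 <= K & forall t h, 0 <= t -> 0 < h -> h <= 1 ->
    `|m n.+1 (t + h) - m n.+1 t
      - h * (n.+1%:R * (theta * m n t - m n.+1 t) + c * n.+1%:R *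
        \sum_(0 <= k < n) m (n - k)%N t * (m k t - m k.+1 t))|
    <= K * (h * Num.sqrt h)) ->
  forall n t, 0 <= t ->
  [/\ forall k, mu.-integrable `[0, t] (EFin \o m k),
      forall i j k, mu.-integrable `[0, t]
        (EFin \o (fun s => m i s * (m j s - m k s))),
      m n.+1 t = m n.+1 0 - n.+1%:R * \int[mu]_(s in `[0, t]) m n.+1 s
          + n.+1%:R * theta * \int[mu]_(s in `[0, t]) m n s
          + c * n.+1%:R * \sum_(0 <= k < n)
              \int[mu]_(s in `[0, t])
                (m (n - k)%N s * (m k s - m k.+1 s)) &
      is_derive_halfline (m n.+1) t
          (- (n.+1%:R * m n.+1 t) + n.+1%:R * theta * m n t
           + c * n.+1%:R * \sum_(0 <= k < n)
               (m (n - k)%N t * (m k t - m k.+1 t)))].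
Proof.
move=> hold incr n t t0.
have cm k : continuous (ext (m k)).
  by have [K K0 hK] := hold k; exact: continuous_holder hK.
have cp j k l : continuous (ext (fun s => m j s * (m k s - m l s))).
  by move=> s; apply: cvgM; [exact: cm|apply: cvgB; exact: cm].
pose S s := \sum_(0 <= k < n) m (n - k)%N s * (m k s - m k.+1 s).
have cS : continuous (ext S) by apply: continuous_sum => k; exact: cp.
pose g s := - (n.+1%:R * m n.+1 s) + n.+1%:R * theta * m n s + c * n.+1%:R * S s.
have cZ (r : R) f : continuous (ext f) -> continuous (ext (fun s => r * f s)).
  by move=> cf s; apply: cvgM; [exact: cvg_cst|exact: cf].
have cN f : continuous (ext f) -> continuous (ext (fun s => - f s)).
  by move=> cf s; apply: cvgN; exact: cf.
have cg1 : continuous (ext (fun s => - (n.+1%:R * m n.+1 s) + n.+1%:R * theta * m n s)).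
  move=> s; apply: cvgD; [exact: cN (fun s => n.+1%:R * m n.+1 s) (cZ _ _ (cm _)) s|].
  exact: cZ _ _ (cm _) s.
have cg : continuous (ext g) by move=> s; apply: cvgD; [exact: cg1|exact: cZ _ _ cS s].
have [K1 K10 hK1] := hold n.+1; have [K K0 hK] := incr n.
have hK' s h : 0 <= s -> 0 < h -> h <= 1 ->
    `|m n.+1 (s + h) - m n.+1 s - h * g s| <= K * (h * Num.sqrt h).
  move=> s0 h0 h1; have := hK s h s0 h0 h1; rewrite -/(S s).
  suff -> : n.+1%:R * (theta * m n s - m n.+1 s) + c * n.+1%:R * S s = g s by [].
  by rewrite /g; ring.
have [dm im] := halfline_ode K10 K0 hK1 hK' cg t0.
split => //.
- by move=> k; exact: integrable_halfline.
- by move=> i j k; exact: integrable_halfline.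
rewrite im /g RintegralD//; last 2 first.
- exact: integrable_halfline.
- by apply: integrable_halfline; exact: cZ.
rewrite RintegralD//; last 2 first.
- apply: (integrable_halfline (f := fun s => - (n.+1%:R * m n.+1 s))).
  exact: cN (fun s => n.+1%:R * m n.+1 s) (cZ _ _ (cm _)).
- by apply: integrable_halfline; exact: cZ.
have -> : \int[mu]_(s in `[0, t]) - (n.+1%:R * m n.+1 s) =
    - n.+1%:R * \int[mu]_(s in `[0, t]) m n.+1 s.
  under eq_Rintegral do rewrite -mulNr.
  by rewrite RintegralZl//; exact: integrable_halfline.
rewrite !RintegralZl//; try exact: integrable_halfline.
by rewrite Rintegral_sum_halfline// mulNr !addrA.
Qed.

End HalfLine.

(** * The free Jacobi process in the operator algebra *)

Section JacobiOperators.
Context {R : realType} {H : completeNormedModType R[i]}.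
Context (ip : {dot H for Num.conj}) (A : set (H -> H)) (F : R -> set (H -> H)).
Context (Phi : (H -> H) -> R[i]) (W : filtered_Wstar_space ip A F Phi).
Context (lambda theta : R) (P Q : H -> H) (X Z Y : R -> H -> H).
Hypothesis fj : free_jacobi_setting ip A F Phi lambda theta P Q X Z Y.
Hypothesis c_neq0 : lambda * theta != 0.
Local Notation T := (opalg W).
Local Notation star := (@opstar _ _ _ _ _ _ W).
Local Notation tau := (@optau _ _ _ _ _ _ W).
Local Notation toT := (@to_op _ _ _ _ _ _ W).
Local Notation opF := (@opfilt _ _ _ _ _ _ W).
Let filtP := fspace_filtration W.
Let tsP : tracial_star star tau := @opalg_tracial _ _ _ _ _ _ W.

Let FA t a : 0 <= t -> F t a -> A a.
Proof. by move=> t0; exact: (filtration_sub filtP t0). Qed.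

Let YP := fj_Y fj.
Let AY t : 0 <= t -> A (Y t).
Proof. by move=> t0; exact: FA t0 (fmbm_adapted YP t0). Qed.
Let AX t : 0 <= t -> A (X t).
Proof. by move=> t0; exact: FA t0 (fbm_adapted (fj_X fj) t0). Qed.
Let AP : A P := FA (lexx 0) (fj_P0 fj).
Let AQ : A Q := FA (lexx 0) (fj_Q0 fj).

Let PP : toT P * toT P = toT P.
Proof. by apply: op_of_inj; rewrite op_ofM !to_opK//; have [_ ->] := fj_P fj. Qed.
Let QQ : toT Q * toT Q = toT Q.
Proof. by apply: op_of_inj; rewrite op_ofM !to_opK//; have [_ ->] := fj_Q fj. Qed.
Let starP : star (toT P) = toT P.
Proof. by apply: opstar_unique; rewrite !to_opK//; have [] := fj_P fj. Qed.
Let starQ : star (toT Q) = toT Q.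
Proof. by apply: opstar_unique; rewrite !to_opK//; have [] := fj_Q fj. Qed.

Let YY t : 0 <= t ->
  star (toT (Y t)) * toT (Y t) = 1 /\ toT (Y t) * star (toT (Y t)) = 1.
Proof.
move=> t0; have [h1 h2] := fmbm_unitary YP t0.
by split; apply: op_of_inj; rewrite op_ofM op_of_star op_of1 to_opK//; exact: AY.
Qed.

Let jacobi_word n t : 0 <= t -> corner_exp P (jacobi ip P Q Y t) n =
  op_of ((toT P * (toT (Y t) * toT Q * star (toT (Y t)))) ^+ n * toT P).
Proof.
move=> t0; set U := toT (Y t) * toT Q * star (toT (Y t)).
have PA k : toT P * ((toT P * U) ^+ k * toT P) = (toT P * U) ^+ k * toT P.
  by case: k => [|k]; rewrite ?expr0 ?mul1r// exprS !mulrA PP.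
elim: n => [|n IH]; first by rewrite expr0 mul1r to_opK.
rewrite /corner_exp iterS -/(corner_exp _ _ _) IH.
have -> : jacobi ip P Q Y t = op_of (toT P * U * toT P).
  by rewrite !op_ofM op_of_star !to_opK//; exact: AY.
rewrite -[LHS]op_ofM; congr op_of.
by rewrite -(mulrA (toT P * U)) PA mulrA -exprS.
Qed.

Let mom n t : R :=
  retr tau ((toT P * (toT (Y t) * toT Q * star (toT (Y t)))) ^+ n * toT P).

Let momentE n t : 0 <= t ->
  moment Phi (lambda * theta) P (jacobi ip P Q Y) n t = (lambda * theta)^-1 * mom n t.
Proof.
move=> t0; rewrite /moment /compressed_state jacobi_word// /mom /retr /optau.
by case: (Phi _) => x y /=; rewrite mul0r subr0.
Qed.

Let integrals : exists ID : R -> T * T, forall t, 0 <= t ->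
  [/\ L2_integral star tau opF (fun s => toT (X s)) (fun s => toT (Y s)) t (ID t).1,
      L2_integral star tau opF (fun s => s%:C%:A) (fun s => toT (Y s)) t (ID t).2 &
      toT (Y t) = toT (Y 0) + 'i%C *: (ID t).1 - (2^-1)%:C *: (ID t).2].
Proof.
pose S t (p : T * T) := 0 <= t ->
  [/\ L2_integral star tau opF (fun s => toT (X s)) (fun s => toT (Y s)) t p.1,
      L2_integral star tau opF (fun s => s%:C%:A) (fun s => toT (Y s)) t p.2 &
      toT (Y t) = toT (Y 0) + 'i%C *: p.1 - (2^-1)%:C *: p.2].
(* The integrals are given for each time separately and are chosen as functions of time, with value
   0 at negative times. *)
suff h t : exists p, S t p
  by exists (fun t => sval (cid (h t))) => t; exact: svalP (cid (h t)).
have [t0|t0] := boolP (0 <= t); last by exists (0, 0) => t0'; rewrite t0' in t0.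
have [I [D [AI AD hI hD YE]]] := fmbm_sde YP t0.
exists (toT I, toT D) => _ /=.
have YK s : 0 <= s -> op_of (toT (Y s)) = Y s by move=> s0; rewrite to_opK//; exact: AY.
split.
- apply: opalg_L2_integral hI => //.
  by move=> s s0; rewrite to_opK//; exact: AX.
- by apply: opalg_L2_integral hD.
- apply: op_of_inj; rewrite op_ofB op_ofD !op_ofZ !to_opK//; exact: AY.
Qed.

Lemma jacobi_moment_hierarchy n t : 0 <= t ->
  let m := moment Phi (lambda * theta) P (jacobi ip P Q Y) in
  let mu := @lebesgue_measure R in
  [/\ forall k, mu.-integrable `[0, t] (EFin \o m k),
      forall i j k, mu.-integrable `[0, t]
        (EFin \o (fun s => m i s * (m j s - m k s))),
      m n.+1 t = m n.+1 0 - n.+1%:R * \int[mu]_(s in `[0, t]) m n.+1 s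
          + n.+1%:R * theta * \int[mu]_(s in `[0, t]) m n s
          + lambda * theta * n.+1%:R * \sum_(0 <= k < n)
              \int[mu]_(s in `[0, t])
                (m (n - k)%N s * (m k s - m k.+1 s)) &
      is_derive_halfline (m n.+1) t
          (- (n.+1%:R * m n.+1 t) + n.+1%:R * theta * m n t
           + lambda * theta * n.+1%:R * \sum_(0 <= k < n)
               (m (n - k)%N t * (m k t - m k.+1 t)))].
Proof.
move=> t0 m mu; have [ID hID] := integrals.
have bmP := opalg_free_bm W (fj_X fj).
have sfP := @opalg_filtration _ _ _ _ _ _ W.
have FY s : 0 <= s -> opF s (toT (Y s)).
  by move=> s0; apply: opfilt_to_op => //; exact: fmbm_adapted YP _ s0.
have YI s : 0 <= s -> L2_integral star tau opF (fun s => toT (X s))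
    (fun s => toT (Y s)) s (ID s).1.
  by move=> /hID[].
have YD s : 0 <= s -> L2_integral star tau opF (fun s => s%:C%:A)
    (fun s => toT (Y s)) s (ID s).2.
  by move=> /hID[].
have YE s : 0 <= s -> toT (Y s) = toT (Y 0) + 'i%C *: (ID s).1 - (2^-1)%:C *: (ID s).2.
  by move=> /hID[].
have tauQ : tau (toT Q) = theta%:C by rewrite /optau to_opK//; exact: fj_trQ fj.
have FP : opF 0 (toT P) by apply: opfilt_to_op => //; exact: fj_P0 fj.
have FQ : opF 0 (toT Q) by apply: opfilt_to_op => //; exact: fj_Q0 fj.
have hold := jacobi_moment_holder tsP sfP bmP FY YY YI YD YE starP starQ PP QQ.
have incr := jacobi_moment_increment tsP sfP bmP FY YY YI YD YE FP FQ starP starQ PP QQ tauQ.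
have mE k s : 0 <= s -> m k s = (lambda * theta)^-1 * mom k s := @momentE k s.
apply: moment_hierarchy => //.
  move=> k; have [K K0 hK] := hold k; exists (`|(lambda * theta)^-1| * K).
    by rewrite mulr_ge0.
  move=> s h s0 h0 h1; rewrite !mE ?addr_ge0 ?(ltW h0)// -mulrBr normrM -mulrA.
  by apply: ler_wpM2l => //; exact: hK.
move=> k; have [K K0 hK] := incr k; exists (`|(lambda * theta)^-1| * K).
  by rewrite mulr_ge0.
move=> s h s0 h0 h1.
under eq_bigr do rewrite !mE//.
rewrite !mE ?addr_ge0 ?(ltW h0)//.
have := ler_wpM2l (normr_ge0 (lambda * theta)^-1) (hK s h s0 h0 h1).
rewrite (mulrA _ K) -normrM => le1; apply: le_trans le1.
rewrite le_eqVlt; apply/orP; left; apply/eqP; congr (`|_|).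
rewrite big_mkord.
(* A product of two normalised moments carries the inverse square of [lambda * theta], the other
   terms its inverse: this is the origin of the coefficient [lambda * theta] of the quadratic
   sum. *)
have -> : \sum_(j < k) (lambda * theta)^-1 * mom (k - j)%N s *
    ((lambda * theta)^-1 * mom j s - (lambda * theta)^-1 * mom j.+1 s) =
  (lambda * theta)^-1 ^+ 2 * \sum_(j < k) mom (k - j)%N s * (mom j s - mom j.+1 s).
  by rewrite mulr_sumr; apply: eq_bigr => j _; ring.
rewrite /mom; move: c_neq0; set c := lambda * theta => c0.
by field.
Qed.

End JacobiOperators.

Theorem corollary2 (R : realType) (H : completeNormedModType R[i])
    (ip : {dot H for Num.conj}) (A : set (H -> H)) (F : R -> set (H -> H))
    (Phi : (H -> H) -> R[i]) (lambda theta : R) (P Q : H -> H)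
    (X Z Y : R -> H -> H)
    (space : filtered_Wstar_space ip A F Phi)
    (lambda_gt0 : 0 < lambda) (lambda_le1 : lambda <= 1)
    (theta_gt0 : 0 < theta) (theta_lt1 : theta < 1)
    (theta_lambda : 1 + lambda <= theta^-1)
    (setting : free_jacobi_setting ip A F Phi lambda theta P Q X Z Y)
    (J0_inv : corner_invertible A P (jacobi ip P Q Y 0))
    (PJ0_inv : corner_invertible A P (P - jacobi ip P Q Y 0)) :
  let J := jacobi ip P Q Y in
  let m := moment Phi (lambda * theta) P J in
  let mu := @lebesgue_measure R in
  forall (n : nat) (t : R), (2 <= n)%N -> 0 <= t ->
    (t%:E < jacobi_time P J)%E ->
    [/\ mu.-integrable `[0, t] (EFin \o m n),
        mu.-integrable `[0, t] (EFin \o m (n - 1)%N),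
        (forall k : nat, (k <= n - 2)%N -> mu.-integrable `[0, t]
           (EFin \o (fun s => m (n - k - 1)%N s * (m k s - m k.+1 s)))),
        m n t = m n 0 - n%:R * \int[mu]_(s in `[0, t]) m n s
          + n%:R * theta * \int[mu]_(s in `[0, t]) m (n - 1)%N s
          + lambda * theta * n%:R * \sum_(0 <= k < n.-1)
              \int[mu]_(s in `[0, t])
                (m (n - k - 1)%N s * (m k s - m k.+1 s)) &
        is_derive_halfline (m n) t
          (- (n%:R * m n t) + n%:R * theta * m (n - 1)%N t
           + lambda * theta * n%:R * \sum_(0 <= k < n.-1)
               (m (n - k - 1)%N t * (m k t - m k.+1 t)))].
Proof.
move=> J m mu [|n] t // _ t0 _.
have c0 : lambda * theta != 0 by rewrite mulf_neq0// gt_eqF.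
have [i1 i2 e1 e2] := jacobi_moment_hierarchy space setting c0 n t0.
have subE k : (n.+1 - k - 1 = n - k)%N by rewrite subnAC subn1.
rewrite subn1 /=; split => //.
- by under eq_bigr do under eq_Rintegral do rewrite subE.
- by under eq_bigr do rewrite subE.
Qed.
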